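(* Let $G$ be a faithful weakly hyperbolic group. The following conditions are equivalent: (a) $G$ is lim-free; (b) for any general type action of $G$ on a hyperbolic space $S$ with trivial elliptic radical $E_S(G)$, the induced action of $G$ on the limit set $\Lambda_S(G)$ is topologically free; (c) $G$ is MIF (mixed identity free).
   Context: A hyperbolic space is a geodesic metric space $S$ (not assumed proper) such that for some $\delta\ge 0$, $\langle x|y\rangle_o\ge\min\{\langle x|z\rangle_o,\langle z|y\rangle_o\}-\delta$ for all $x,y,z,o\in S$, where $\langle x|y\rangle_o=\frac12(d(x,o)+d(y,o)-d(x,y))$. Its Gromov boundary $\partial S$ is the set of equivalence classes of sequences $(x_i)$ in $S$ with $\langle x_i|x_j\rangle_o\to\infty$ as $i,j\to\infty$, where $(x_i)\sim(y_i)$ iff $\langle x_i|y_j\rangle_o\to\infty$; a sequence in the class $a$ is said to converge to $a$. For $a,b\in\partial S$, $\langle a|b\rangle_o$ is the infimum of $\liminf_{i,j}\langle x_i|y_j\rangle_o$ over sequences $x_i\to a$, $y_j\to b$; $\partial S$ is topologized so that the sets $\{b\in\partial S:\langle a|b\rangle_o>r\}$, $r\ge 0$, form a neighborhood base at $a$. All group actions on hyperbolic spaces are by isometries; they extend to actions by homeomorphisms on $\partial S$. The limit set $\Lambda_S(G)\subseteq\partial S$ of a group $G$ acting on $S$ is the set of points of $\partial S$ that are limits of sequences in an orbit $Gs$ (independent of $s\in S$), with the subspace topology. An element $g\in G$ is loxodromic if $\langle g\rangle$ has unbounded orbits in $S$ and fixes exactly two points of $\partial S$. The action of $G$ on $S$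 is of general type if its orbits are unbounded and $G$ contains two loxodromic elements with disjoint fixed point sets in $\partial S$. The elliptic radical of $G$ with respect to an action on $S$ is $E_S(G)=\{g\in G\mid gs=s\ \forall s\in\Lambda_S(G)\}$. An action by homeomorphisms on a topological space $X$ is topologically free if for every nontrivial element $g$ the set of fixed points of $g$ in $X$ has empty interior. A group is weakly hyperbolic if it admits a general type action on a hyperbolic space. It is faithful weakly hyperbolic if it admits a general type action on a hyperbolic space such that the induced action on the limit set is faithful. A weakly hyperbolic group is lim-free if it admits a general type action on a hyperbolic space such that the induced action on the limit set is topologically free. Let $F_n$ be the free group of rank $n$. A group $G$ satisfies a mixed identity $w=1$, $w\in G*F_n$, if every homomorphism $G*F_n\to G$ that is the identity on $G$ sends $w$ to $1$. The mixed identity is non-trivial if $w\ne1$ in $G*F_n$. $G$ is MIF if it satisfies no non-trivial mixed identity (for any $n$). *)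

(* Defs.v *)
From HB Require Import structures.
From mathcomp Require Import all_boot all_order all_algebra.
From mathcomp Require Import generic_quotient.
From mathcomp Require Import all_classical all_reals all_analysis.

Set Implicit Arguments.
Unset Strict Implicit.
Unset Printing Implicit Defensive.

Import Order.TTheory GRing.Theory Num.Theory.
Local Open Scope classical_set_scope.
Local Open Scope ring_scope.
Local Open Scope quotient_scope.

Section HyperbolicSpace.
Context {R : realType}.

Definition geodesic (S : metricType R) : Prop :=
  forall x y : S, exists c : R -> S,
    [/\ c 0 = x, c (mdist x y) = y &
        forall s t, s \in `[0, mdist x y] -> t \in `[0, mdist x y] ->
          mdist (c s) (c t) = `|s - t|].

Definition gromov_product {S : metricType R} (o x y : S) : R :=
  (mdist x o + mdist y o - mdist x y) / 2.

Definition hyperbolic (S : metricType R) : Prop :=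
  geodesic S /\
  exists2 delta : R, 0 <= delta &
    forall x y z o : S,
      Num.min (gromov_product o x z) (gromov_product o z y) - delta
        <= gromov_product o x y.

End HyperbolicSpace.

(* Changing the base point [o] changes a Gromov product by at most the distance
   between the two base points, so the quantifications over [o] below amount to
   fixing any one base point. *)
Section GromovBoundary.
Context {R : realType} {S : metricType R}.
Implicit Types x y : nat -> S.

Definition gromov_sim x y : Prop :=
  forall o : S,
    gromov_product o (x ij.1) (y ij.2) @[ij --> (\oo, \oo)] --> +oo.

Definition gromov_seq x : Prop := gromov_sim x x.

Definition gromov_class x : set (nat -> S) :=
  [set y | gromov_seq y /\ gromov_sim x y].

End GromovBoundary.

Record boundary (R : realType) (S : metricType R) := Boundary {
  bclass : set (nat -> S);
  bclassP : exists2 x, gromov_seq x & bclass = gromov_class x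
}.

HB.instance Definition _ (R : realType) (S : metricType R) :=
  gen_eqMixin (boundary S).
HB.instance Definition _ (R : realType) (S : metricType R) :=
  gen_choiceMixin (boundary S).

Section BoundaryTopology.
Context {R : realType} {S : metricType R}.
Implicit Types (x y : nat -> S) (a b : boundary S).

Lemma boundary_inj a b : bclass a = bclass b -> a = b.
Proof.
case: a b => [A hA] [B hB] /= eAB; case: _ / eAB in hB *.
by rewrite (Prop_irrelevance hA hB).
Qed.

Definition converges_to x a : Prop := bclass a x.

Definition boundary_product (o : S) a b : \bar R :=
  ereal_inf [set e : \bar R | exists x y, [/\ converges_to x a,
    converges_to y b &
    e = limf_einf (fun ij : nat * nat =>
          (gromov_product o (x ij.1) (y ij.2))%:E)
        (filter_prod \oo \oo)]].

Definition boundary_open (U : set (boundary S)) : Prop :=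
  forall a, U a -> forall o : S, exists2 r : R, 0 <= r &
    [set b | (r%:E < boundary_product o a b)%E] `<=` U.

Lemma boundary_openT : boundary_open setT.
Proof. by move=> a _ o; exists 0. Qed.

Lemma boundary_openI : setI_closed boundary_open.
Proof.
move=> U V Uop Vop a [Ua Va] o.
have [r r0 rU] := Uop a Ua o; have [s s0 sV] := Vop a Va o.
exists (Num.max r s); first by rewrite le_max r0.
move=> b /= rsb; split; [apply: rU|apply: sV]; apply: le_lt_trans rsb => /=;
  by rewrite lee_fin le_max lexx ?orbT.
Qed.

Lemma boundary_open_bigU (I : Type) (f : I -> set (boundary S)) :
  (forall i, boundary_open (f i)) -> boundary_open (\bigcup_i f i).
Proof.
move=> fop a [i _ fia] o; have [r r0 rf] := fop i a fia o.
by exists r => // b /rf fib; exists i.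
Qed.

End BoundaryTopology.

HB.instance Definition _ (R : realType) (S : metricType R) :=
  isOpenTopological.Build (boundary S)
    boundary_openT boundary_openI boundary_open_bigU.

Record isom_action (R : realType) (G : groupType) (S : metricType R) :=
  IsomAction {
    act :> G -> S -> S;
    act1 : forall s, act 1%g s = s;
    actM : forall g h s, act (g * h)%g s = act g (act h s);
    act_isom : forall g s t, mdist (act g s) (act g t) = mdist s t
  }.

Section BoundaryAction.
Context {R : realType} {G : groupType} {S : metricType R}.
Variable A : isom_action G S.
Implicit Types (g h : G) (x y : nat -> S) (a : boundary S).

Lemma actK g : cancel (A g) (A g^-1%g).
Proof. by move=> s; rewrite -actM mulVg act1. Qed.

Lemma actKV g : cancel (A g^-1%g) (A g).
Proof. by move=> s; rewrite -actM mulgV act1. Qed.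

Lemma gromov_product_act g o s t :
  gromov_product o (A g s) (A g t) = gromov_product (A g^-1%g o) s t.
Proof.
by rewrite /gromov_product act_isom -{1 2}(actKV g o) !act_isom.
Qed.

Lemma gromov_sim_act g x y :
  gromov_sim x y -> gromov_sim (A g \o x) (A g \o y).
Proof.
move=> xy o; have := xy (A g^-1%g o); apply: cvg_trans; apply: near_eq_cvg.
by apply: nearW => ij /=; rewrite gromov_product_act.
Qed.

Lemma boundary_act_subproof g a :
  exists2 x, gromov_seq x & [set A g \o y | y in bclass a] = gromov_class x.
Proof.
have [x xS ->] := bclassP a; exists (A g \o x); first exact: gromov_sim_act.
have AgK y : A g \o (A g^-1%g \o y) = y.
  by apply/funext => n /=; rewrite actKV.
have AgVK y : A g^-1%g \o (A g \o y) = y.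
  by apply/funext => n /=; rewrite actK.
apply/seteqP; split => [_ [y [yS xy] <-]|y [yS xy]].
  by split; exact: gromov_sim_act.
exists (A g^-1%g \o y); last exact: AgK.
by split; [|rewrite -(AgVK x)]; exact: gromov_sim_act.
Qed.

Definition boundary_act g a : boundary S :=
  Boundary (boundary_act_subproof g a).

Definition orbit_of (H : set G) (s : S) : set S := [set A h s | h in H].

Definition limit_set : set (boundary S) :=
  [set a | exists s x, (forall n, orbit_of setT s (x n)) /\ converges_to x a].

Lemma limit_set_act g a : limit_set a -> limit_set (boundary_act g a).
Proof.
move=> [s [x [xs xa]]]; exists s, (A g \o x); split; last by exists x.
by move=> n /=; have [h _ <-] := xs n; exists (g * h)%g; rewrite ?actM.
Qed.

Definition limit_act (g : G) (a : limit_set) : limit_set :=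
  exist (fun b => b \in limit_set) (boundary_act g (set_val a))
    (mem_set (limit_set_act g (set_mem (valP a)))).

Definition elliptic_radical : set G :=
  [set g | forall a, limit_set a -> boundary_act g a = a].

Definition metric_bounded (B : set S) : Prop :=
  exists M : R, forall s t, B s -> B t -> mdist s t <= M.

Definition unbounded_orbits (H : set G) : Prop :=
  forall s : S, ~ metric_bounded (orbit_of H s).

Definition cyclic_subgroup (g : G) : set G :=
  [set h | exists n : nat, h = (g ^+ n)%g \/ h = (g ^- n)%g].

Definition boundary_fix (H : set G) : set (boundary S) :=
  [set a | forall h, H h -> boundary_act h a = a].

Definition loxodromic (g : G) : Prop :=
  unbounded_orbits (cyclic_subgroup g) /\
  exists a b, a <> b /\ boundary_fix (cyclic_subgroup g) = [set a; b].

Definition general_type : Prop :=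
  unbounded_orbits setT /\
  exists g h, [/\ loxodromic g, loxodromic h &
    boundary_fix [set g] `&` boundary_fix [set h] = set0].

End BoundaryAction.

Arguments limit_act {R G S} A g a.

Definition faithful_action (G : groupType) (X : Type) (f : G -> X -> X) : Prop :=
  forall g, (forall x, f g x = x) -> g = 1%g.

Definition topologically_free (G : groupType) (X : topologicalType)
    (f : G -> X -> X) : Prop :=
  forall g, g <> 1%g -> interior [set x | f g x = x] = set0.

Definition weakly_hyperbolic (R : realType) (G : groupType) : Prop :=
  exists (S : metricType R) (A : isom_action G S),
    hyperbolic S /\ general_type A.

Definition faithful_weakly_hyperbolic (R : realType) (G : groupType) : Prop :=
  exists (S : metricType R) (A : isom_action G S),
    [/\ hyperbolic S, general_type A & faithful_action (limit_act A)].

Definition lim_free (R : realType) (G : groupType) : Prop :=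
  weakly_hyperbolic R G /\
  exists (S : metricType R) (A : isom_action G S),
    [/\ hyperbolic S, general_type A & topologically_free (limit_act A)].

(* Groups given by generators and relators.  A word is a sequence of letters
   [(x, b)]; [(x, true)] stands for the generator [x] and [(x, false)] for its
   inverse. *)
Section Presentation.
Variables (X : choiceType) (rel : set (seq (X * bool))).
Implicit Types u v w : seq (X * bool).

Inductive word_eq : seq (X * bool) -> seq (X * bool) -> Prop :=
| word_eq_refl u : word_eq u u
| word_eq_sym u v : word_eq u v -> word_eq v u
| word_eq_trans u v w : word_eq u v -> word_eq v w -> word_eq u w
| word_eq_cat u u' v v' :
    word_eq u u' -> word_eq v v' -> word_eq (u ++ v) (u' ++ v')
| word_eq_cancel x b : word_eq [:: (x, b); (x, ~~ b)] [::]
| word_eq_relator r : rel r -> word_eq r [::].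

Definition word_eqb u v : bool := `[< word_eq u v >].

Lemma word_eqb_equiv : equiv_class_of word_eqb.
Proof.
split=> [u|u v|v u w].
- exact/asboolP/word_eq_refl.
- by apply/asboolP/asboolP; exact: word_eq_sym.
- by move=> /asboolP uv /asboolP vw; apply/asboolP; exact: word_eq_trans uv vw.
Qed.

Definition word_equiv : equiv_rel (seq (X * bool)) :=
  EquivRelPack word_eqb_equiv.

Definition presented_group : Type := {eq_quot word_equiv}.

HB.instance Definition _ := Choice.on presented_group.
HB.instance Definition _ := EqQuotient.on presented_group.

Definition word_class w : presented_group := \pi_presented_group w.

Lemma word_classP u v : word_class u = word_class v <-> word_eq u v.
Proof.
split=> [/eqmodP/asboolP //|uv]; exact/eqmodP/asboolP.
Qed.

Lemma word_class_repr (a : presented_group) : word_class (repr a) = a.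
Proof. exact: reprK. Qed.

Lemma word_eq_repr w : word_eq (repr (word_class w)) w.
Proof. by apply/word_classP; rewrite word_class_repr. Qed.

Definition word_inv w := rev [seq (l.1, ~~ l.2) | l <- w].

Lemma word_eq_invr w : word_eq (w ++ word_inv w) [::].
Proof.
elim: w => [|[x b] w IHw]; first exact: word_eq_refl.
have -> : ((x, b) :: w) ++ word_inv ((x, b) :: w) =
    [:: (x, b)] ++ ((w ++ word_inv w) ++ [:: (x, ~~ b)]).
  by rewrite /word_inv /= rev_cons -cats1 catA.
apply: word_eq_trans (word_eq_cancel x b).
rewrite -[X in word_eq _ X]/([:: (x, b)] ++ ([::] ++ [:: (x, ~~ b)])).
by do 2?apply: word_eq_cat => //; exact: word_eq_refl.
Qed.

Lemma word_invK : involutive word_inv.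
Proof.
move=> w; rewrite /word_inv map_rev revK -map_comp -[RHS]map_id.
by apply: eq_map => -[x b] /=; rewrite negbK.
Qed.

Lemma word_eq_invl w : word_eq (word_inv w ++ w) [::].
Proof. by rewrite -{2}(word_invK w); exact: word_eq_invr. Qed.

Lemma word_eq_inv u v : word_eq u v -> word_eq (word_inv u) (word_inv v).
Proof.
move=> uv; have r w : word_eq w w by exact: word_eq_refl.
apply: (@word_eq_trans _ (word_inv u ++ (v ++ word_inv v))).
  rewrite -{1}[word_inv u]cats0; apply: word_eq_cat => //.
  exact/word_eq_sym/word_eq_invr.
rewrite catA -{2}[word_inv v]cat0s; apply: word_eq_cat => //.
apply: word_eq_trans (word_eq_invl u); apply: word_eq_cat => //.
exact: word_eq_sym.
Qed.

Let pone : presented_group := word_class [::].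
Let pmul (a b : presented_group) := word_class (repr a ++ repr b).
Let pinv (a : presented_group) := word_class (word_inv (repr a)).

Let pmulE u v : pmul (word_class u) (word_class v) = word_class (u ++ v).
Proof. by apply/word_classP; apply: word_eq_cat; exact: word_eq_repr. Qed.

Let pinvE u : pinv (word_class u) = word_class (word_inv u).
Proof. by apply/word_classP; apply: word_eq_inv; exact: word_eq_repr. Qed.

Let pmulA : associative pmul.
Proof.
move=> a b c.
by rewrite -(word_class_repr a) -(word_class_repr b) -(word_class_repr c)
  !pmulE catA.
Qed.

Let pmul1 : left_id pone pmul.
Proof. by move=> a; rewrite -(word_class_repr a) pmulE. Qed.

Let pmulr1 : right_id pone pmul.
Proof. by move=> a; rewrite -(word_class_repr a) pmulE cats0. Qed.

Let pmulV : left_inverse pone pinv pmul.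
Proof.
move=> a; rewrite -(word_class_repr a) pinvE pmulE.
exact/word_classP/word_eq_invl.
Qed.

Let pmulrV : right_inverse pone pinv pmul.
Proof.
move=> a; rewrite -(word_class_repr a) pinvE pmulE.
exact/word_classP/word_eq_invr.
Qed.

HB.instance Definition _ :=
  isGroup.Build presented_group pmulA pmul1 pmulr1 pmulV pmulrV.

Lemma word_classM u v :
  word_class (u ++ v) = (word_class u * word_class v)%g.
Proof. by rewrite -pmulE. Qed.

Lemma word_class1 : word_class [::] = 1%g.
Proof. by []. Qed.

Lemma word_classV u : word_class (word_inv u) = (word_class u)^-1%g.
Proof. by rewrite -pinvE. Qed.

End Presentation.

Definition free_group (X : choiceType) : groupType :=
  presented_group (set0 : set (seq (X * bool))).

Section FreeProduct.
Variables G H : groupType.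

(* The multiplication tables of [G] and [H]. *)
Definition free_product_relators : set (seq ((G + H) * bool)) :=
  [set [:: (inl p.1, true); (inl p.2, true); (inl (p.1 * p.2)%g, false)]
     | p in [set: G * G]] `|`
  [set [:: (inr p.1, true); (inr p.2, true); (inr (p.1 * p.2)%g, false)]
     | p in [set: H * H]].

Definition free_product : groupType := presented_group free_product_relators.

Definition free_product_inl (g : G) : free_product :=
  word_class free_product_relators [:: (inl g, true)].

End FreeProduct.

Definition mixed_identity (G : groupType) (n : nat)
    (w : free_product G (free_group 'I_n)) : Prop :=
  forall f : {multiplicative free_product G (free_group 'I_n) -> G},
    (forall g : G, f (free_product_inl _ g) = g) -> f w = 1%g.

Definition MIF (G : groupType) : Prop :=
  forall (n : nat) (w : free_product G (free_group 'I_n)),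
    mixed_identity w -> w = 1%g.

(* Main.v *)
(* Everything is done with Gromov products of orbit points; the space need only
   satisfy the four-point inequality.

   lim-free => MIF.  Write a nontrivial [w] in [G * F_n] as a reduced word
   [g0 x_s1 g1 x_s2 g2 ...].  Topological freeness gives a limit point [a] moved
   by every nontrivial [g_k], hence a neighborhood of [a] that every such [g_k]
   carries off itself.  The limit set is perfect, so this neighborhood contains
   [2n] distinct limit points, and there are [x_i] in [G] for which [x_i o] and
   [x_i^-1 o] are far away in the directions of these points.  Then the value of
   [w] moves [o] a long way, as in the ping-pong lemma.

   MIF => topologically free.  Suppose [g <> 1] fixes a neighborhood of [a] in
   the limit set.  Conjugating [g] by elements [t1], [t2] that push the
   complement of this neighborhood into small, distant shadows gives [g1], [g2]
   supported in these shadows.  For every [x], comparing cross ratios at [o] and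
   at [x^-1 o] shows that [g_i] and [x^-1 g_j x] have disjoint supports for some
   [i], [j], hence commute since the elliptic radical is trivial.  In a MIF
   group some [x] makes all four commutators nontrivial. *)

Require Import Defs.
From HB Require Import structures.
From mathcomp Require Import all_boot all_order all_algebra.
From mathcomp Require Import all_classical all_reals all_analysis.
From mathcomp Require Import lra.

Set Implicit Arguments.
Unset Strict Implicit.
Unset Printing Implicit Defensive.

Import Order.TTheory GRing.Theory Num.Theory.
Local Open Scope classical_set_scope.

(** * Words and mixed identities *)

Section GroupHom.
Local Open Scope group_scope.
Variables (G K : groupType) (f : {multiplicative G -> K}).

Lemma hom1 : f 1 = 1.
Proof. by apply: (mulgI (f 1)); rewrite -gmulfM !mulg1. Qed.

Lemma homV g : f g^-1 = (f g)^-1.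
Proof. by apply/esym/mulg1_eq; rewrite -gmulfM mulgV hom1. Qed.

Lemma homJ g h : f (g ^ h) = f g ^ f h.
Proof. by rewrite !conjgE !gmulfM homV. Qed.

Lemma homR g h : f [~ g, h] = [~ f g, f h].
Proof. by rewrite !commgEl gmulfM homV homJ. Qed.

End GroupHom.

(** * Homomorphisms out of presented groups and free products *)

Section PresentedLift.
Local Open Scope group_scope.
Variables (X : choiceType) (rel : set (seq (X * bool))) (K : groupType).
Variable phi : X -> K.

Definition letter_eval (l : X * bool) : K :=
  if l.2 then phi l.1 else (phi l.1)^-1.

Definition word_eval (w : seq (X * bool)) : K :=
  foldr (fun l k => letter_eval l * k) 1 w.

Lemma word_eval_cat u v : word_eval (u ++ v) = word_eval u * word_eval v.
Proof. by elim: u => [|l u IHu] /=; rewrite ?mul1g // IHu mulgA. Qed.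

Lemma word_eval_eq u v : (forall r, rel r -> word_eval r = 1) ->
  word_eq rel u v -> word_eval u = word_eval v.
Proof.
move=> rel1; elim=> // {u v}.
- by move=> u v w _ -> _ ->.
- by move=> u u' v v' _ uu' _ vv'; rewrite !word_eval_cat uu' vv'.
- by move=> x [] /=; rewrite /letter_eval /= mulg1 ?mulgV ?mulVg.
Qed.

Lemma presented_lift : (forall r, rel r -> word_eval r = 1) ->
  exists f : {multiplicative presented_group rel -> K},
    forall w, f (word_class rel w) = word_eval w.
Proof.
move=> rel1; pose f (a : presented_group rel) := word_eval (repr a).
have fE w : f (word_class rel w) = word_eval w.
  exact/(word_eval_eq rel1)/word_eq_repr.
have fM : {morph f : a b / a * b}.
  move=> a b; rewrite -(word_class_repr a) -(word_class_repr b).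
  by rewrite -word_classM !fE word_eval_cat.
pose fm : {multiplicative presented_group rel -> K} :=
  HB.pack f (isMultiplicative.Build (presented_group rel) K f fM).
by exists fm.
Qed.

End PresentedLift.

Lemma word_class_relator3 (X : choiceType) (rel : set (seq (X * bool)))
    (a b c : X) :
  rel [:: (a, true); (b, true); (c, false)] ->
  (word_class rel [:: (a, true)] * word_class rel [:: (b, true)] =
    word_class rel [:: (c, true)])%g.
Proof.
move=> rabc; apply: divg1_eq.
have : word_class rel ([:: (a, true)] ++ [:: (b, true)] ++
    word_inv [:: (c, true)]) = 1%g.
  by apply/(@word_classP _ _ _ [::]); exact: word_eq_relator.
by rewrite 2!word_classM word_classV mulgA.
Qed.

Section FreeProductLift.
Local Open Scope group_scope.
Variables (G : groupType) (n : nat).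
Local Notation GF := (free_product G (free_group 'I_n)).

Definition free_product_var (i : 'I_n) : GF :=
  word_class _ [:: (inr (word_class set0 [:: (i, true)]), true)].

Lemma free_product_inlM (g h : G) :
  free_product_inl (free_group 'I_n) (g * h) =
    free_product_inl _ g * free_product_inl _ h.
Proof. by apply/esym/word_class_relator3; left; exists (g, h). Qed.

Lemma free_product_inrM (u v : free_group 'I_n) :
  word_class (@free_product_relators G _) [:: (inr (u * v), true)] =
    word_class _ [:: (inr u, true)] * word_class _ [:: (inr v, true)].
Proof. by apply/esym/word_class_relator3; right; exists (u, v). Qed.

Lemma free_product_lift (K : groupType) (iota : {multiplicative G -> K})
    (gamma : 'I_n -> K) :
  exists f : {multiplicative GF -> K},
    (forall g, f (free_product_inl _ g) = iota g) /\
    (forall i, f (free_product_var i) = gamma i).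
Proof.
have [fF fFE] : exists f : {multiplicative free_group 'I_n -> K},
    forall w, f (word_class set0 w) = word_eval gamma w.
  exact: presented_lift.
pose phi (s : G + free_group 'I_n) :=
  match s with inl g => iota g | inr u => fF u end.
have [|f fE] := @presented_lift _ (@free_product_relators G (free_group 'I_n))
    K phi.
  by move=> r [] [[a b] _ <-];
    rewrite /= /letter_eval /= gmulfM mulg1 mulgA mulgV.
exists f; split=> [g|i]; rewrite fE /= /letter_eval /= mulg1 //.
by rewrite fFE /= /letter_eval mulg1.
Qed.

End FreeProductLift.

(** * Reduced forms in the free product of [G] with a free group *)

Section PresentedInduction.
Local Open Scope group_scope.
Variables (X : choiceType) (rel : set (seq (X * bool))).
Local Notation gen x := (word_class rel [:: (x, true)]).

Lemma presented_ind (P : presented_group rel -> Prop) :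
  P 1 -> (forall x a, P a -> P (gen x * a)) ->
  (forall x a, P a -> P ((gen x)^-1 * a)) -> forall a, P a.
Proof.
move=> P1 PM PV a; rewrite -(word_class_repr a); elim: (repr a) => //= l w IHw.
rewrite -cat1s word_classM; case: l => x [] /=; first exact: PM.
rewrite -[[:: (x, false)]]/(word_inv [:: (x, true)]) word_classV; exact: PV.
Qed.

End PresentedInduction.

Section ReducedForm.
Local Open Scope group_scope.
Variables (G : groupType) (n : nat).
Local Notation GF := (free_product G (free_group 'I_n)).
Local Notation syllables := (seq (('I_n * bool) * G)).

Definition syllable_eval (K : groupType) (iota : G -> K) (x : 'I_n -> K)
    (l : syllables) : K :=
  foldr (fun p k => letter_eval x p.1 * iota p.2 * k) 1 l.

(** Excludes only a letter followed at once by its inverse; a trivial coefficient between other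
    letters is allowed. *)
Definition no_cancel (p q : ('I_n * bool) * G) : bool :=
  (p.2 != 1) || (q.1 != (p.1.1, ~~ p.1.2)).

(** The elements with such a form are stable under left multiplication by generators and their
    inverses. *)
Lemma free_product_reduced (w : GF) :
  exists g l, sorted no_cancel l /\
    w = free_product_inl _ g *
      syllable_eval (@free_product_inl G _) (@free_product_var G n) l.
Proof.
pose ev := syllable_eval (@free_product_inl G _) (@free_product_var G n).
pose P w := exists g l, sorted no_cancel l /\ w = free_product_inl _ g * ev l.
pose Q u := forall w, P w -> P (u * w).
have inl1 : free_product_inl (free_group 'I_n) (1 : G) = 1.
  by apply: (mulgI (free_product_inl _ 1)); rewrite -free_product_inlM !mulg1.
have QM u v : Q u -> Q v -> Q (u * v).
  by move=> Qu Qv x Px; rewrite -mulgA; apply/Qu/Qv.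
have Qinl g : Q (free_product_inl _ g).
  move=> _ [h [l [ls ->]]]; exists (g * h)%g, l; split=> //.
  by rewrite mulgA free_product_inlM.
have Qlet s : Q (letter_eval (@free_product_var G n) s).
  move=> _ [g [l [ls ->]]].
  have [sl|nsl] := boolP (sorted no_cancel ((s, g) :: l)).
    by exists 1, ((s, g) :: l); rewrite inl1 mul1g /ev /= !mulgA.
  (* Prepending [s] breaks reducedness only if [g] is trivial and the first letter of [l] is the
     inverse of [s]; these letters cancel and [h] becomes the leading coefficient. *)
  case: l ls nsl => [//|[s' h] l] /= ls; rewrite ls andbT negb_or !negbK /=.
  case/andP=> /eqP -> /eqP ->; exists h, l.
  split; first exact: path_sorted ls.
  rewrite /ev /= inl1 mul1g !mulgA; case: s {ls} => i [];
    by rewrite /letter_eval /= ?mulgV ?mulVg mul1g.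
have Q1 : Q 1 by move=> x; rewrite mul1g.
have inrV u : word_class (@free_product_relators G _) [:: (inr u^-1, true)] =
    (word_class (@free_product_relators G (free_group 'I_n))
       [:: (inr u, true)])^-1.
  have inr1 : word_class (@free_product_relators G (free_group 'I_n))
      [:: (inr 1, true)] = 1.
    apply: (mulgI (word_class _ [:: (inr 1, true)])).
    by rewrite -free_product_inrM !mulg1.
  by apply/esym/mulg1_eq; rewrite -free_product_inrM mulgV.
have Qinr u : Q (word_class _ [:: (inr u, true)]).
  elim/presented_ind: u => [|x u Qu|x u Qu].
  - by rewrite -(mulgV 1) free_product_inrM inrV mulgV.
  - by rewrite free_product_inrM; apply: QM Qu; exact: (Qlet (x, true)).
  - by rewrite free_product_inrM inrV; apply: QM Qu; exact: (Qlet (x, false)).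
rewrite -/(P w); elim/presented_ind: w => [|[g|u] w|[g|u] w].
- by exists 1, [::]; rewrite inl1 mulg1.
- exact: Qinl.
- exact: Qinr.
- have -> : (word_class (@free_product_relators G (free_group 'I_n))
      [:: (inl g, true)])^-1 = free_product_inl _ g^-1.
    by apply: mulg1_eq; rewrite -free_product_inlM mulgV.
  exact: Qinl.
- by rewrite -inrV; exact: Qinr.
Qed.

Lemma syllable_eval_morph (K K' : groupType) (f : {multiplicative K -> K'})
    (iota : G -> K) (x : 'I_n -> K) (l : syllables) :
  f (syllable_eval iota x l) = syllable_eval (f \o iota) (f \o x) l.
Proof.
elim: l => [|[[i b] g] l IHl] /=; first exact: hom1.
by rewrite !gmulfM IHl; case: b; rewrite /letter_eval //= homV.
Qed.

(** A form without letters is a constant from [G], equal to each of its values; so only words with a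
    letter need a substitution with nontrivial value. *)
Lemma MIF_reduced :
  (forall g (l : syllables), l != [::] -> sorted no_cancel l ->
     exists x : 'I_n -> G, g * syllable_eval id x l <> 1) ->
  forall w : GF, mixed_identity w -> w = 1.
Proof.
move=> Hred w; have [g [l [ls ->]]] := free_product_reduced w => mi.
have val x : g * syllable_eval id x l = 1.
  have [f [fi fx]] := @free_product_lift G n G idfun x.
  have := mi f fi; rewrite gmulfM fi syllable_eval_morph /=.
  rewrite (_ : f \o _ = id); last exact/funext.
  by rewrite (_ : f \o _ = x) //; exact/funext.
have [l0|lN0] := eqVneq l [::]; last first.
  by have [x] := Hred g l lN0 ls; rewrite val.
have := val (fun=> 1); rewrite l0 /= !mulg1 => ->.
apply: (mulgI (free_product_inl _ 1)); rewrite -free_product_inlM !mulg1 //.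
Qed.

End ReducedForm.

(** * An overgroup with a generic conjugator, and commutators in MIF groups *)

Record permutation (T : Type) := Permutation {
  pfun :> T -> T;
  pinv : T -> T;
  pfunK : cancel pfun pinv;
  pinvK : cancel pinv pfun
}.

HB.instance Definition _ (T : Type) := gen_eqMixin (permutation T).
HB.instance Definition _ (T : Type) := gen_choiceMixin (permutation T).

Section PermutationGroup.
Variable T : Type.
Implicit Types p q : permutation T.

Lemma permutation_ext p q : p =1 q -> p = q.
Proof.
case: p q => [f f' fK f'K] [g g' gK g'K] /= /funext fg; subst g.
have fg : f' = g' by apply/funext => x; rewrite -{1}(g'K x) fK.
subst g'; by rewrite (Prop_irrelevance fK gK) (Prop_irrelevance f'K g'K).
Qed.

Definition permutation_one := @Permutation T id id (fun=> erefl) (fun=> erefl).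
Definition permutation_mul p q :=
  Permutation (can_comp (pfunK p) (pfunK q)) (can_comp (pinvK q) (pinvK p)).
Definition permutation_inv p := Permutation (pinvK p) (pfunK p).

Fact permutation_mulA : associative permutation_mul.
Proof. by move=> p q r; exact: permutation_ext. Qed.
Fact permutation_mul1 : left_id permutation_one permutation_mul.
Proof. by move=> p; exact: permutation_ext. Qed.
Fact permutation_mulr1 : right_id permutation_one permutation_mul.
Proof. by move=> p; exact: permutation_ext. Qed.
Fact permutation_mulV :
  left_inverse permutation_one permutation_inv permutation_mul.
Proof. by move=> p; apply: permutation_ext => x /=; rewrite pfunK. Qed.
Fact permutation_mulrV :
  right_inverse permutation_one permutation_inv permutation_mul.
Proof. by move=> p; apply: permutation_ext => x /=; rewrite pinvK. Qed.

HB.instance Definition _ := isGroup.Build (permutation T) permutation_mulA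
  permutation_mul1 permutation_mulr1 permutation_mulV permutation_mulrV.

Lemma permutationM p q x : (p * q)%g x = p (q x).
Proof. by []. Qed.

End PermutationGroup.

Section GenericConjugator.
Local Open Scope group_scope.
Variable G : groupType.

(** Copies of the regular action labelled by [option G]: the copy [None] holds base points, and the
    copies [Some h] are the free orbits that receive them under [flip]. *)
Definition translation (g : G) : permutation (G * option G) :=
  @Permutation (G * option G)
    (fun a => (g * a.1, a.2)) (fun a => (g^-1 * a.1, a.2))
    (fun a => ltac:(by case: a => a o /=; rewrite mulKg))
    (fun a => ltac:(by case: a => a o /=; rewrite mulVKg)).

Lemma translationM : {morph translation : g h / g * h}.
Proof. by move=> g h; apply: permutation_ext => -[a o] /=; rewrite mulgA. Qed.

HB.instance Definition _ :=
  isMultiplicative.Build G (permutation (G * option G))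
    translation translationM.

Definition flip (a : G * option G) : G * option G :=
  match a.2 with
  | None => (1, Some a.1)
  | Some h => if a.1 == 1 then (h, None) else a
  end.

Lemma flipK : involutive flip.
Proof.
move=> [a [h|]]; rewrite /flip /= ?eqxx //.
by case: (eqVneq a 1) => [->|/negbTE aN1] //=; rewrite aN1.
Qed.

Definition flip_perm : permutation (G * option G) := Permutation flipK flipK.

(* [flip] carries the base points [(g, None)] to pairwise distinct free orbits
   of [G], which the conjugate of [v] shifts without returning. *)
Lemma flip_commute (u v : G) : u != 1 -> v != 1 ->
  [~ translation u, translation v ^ flip_perm] != 1.
Proof.
move=> uN1 vN1; apply/commgP => /(congr1 (fun p => pfun p (1, None))).
rewrite conjgE !permutationM /= /flip /= !mulg1 (negbTE vN1) /=.
by case=> _ u1; rewrite u1 eqxx in uN1.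
Qed.

Lemma translation_eq1 (g : G) : translation g = 1 -> g = 1.
Proof.
by move=> /(congr1 (fun p => (pfun p (1, None)).1)) /=; rewrite mulg1.
Qed.

End GenericConjugator.

(** A substitute for [G] inside its free product with an infinite cyclic group: a commutator of
    permutations is seen to be nontrivial at a single point. *)
Lemma exists_generic_conjugator (G : groupType) :
  exists (K : groupType) (f : {multiplicative G -> K}) (t : K),
    (forall g, f g = 1%g -> g = 1%g) /\
    forall u v : G, u != 1%g -> v != 1%g -> [~ f u, f v ^ t]%g != 1%g.
Proof.
exists (permutation (G * option G)), (@translation G), (@flip_perm G).
by split; [exact: translation_eq1|exact: flip_commute].
Qed.

Section MIFConjugator.
Local Open Scope group_scope.

(** A nontrivial image in any group certifies [w != 1], so that MIF yields a nontrivial value in [G]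
    itself. *)
Lemma MIF_nontrivial_value (G : groupType) (n : nat) (K : groupType)
    (f : {multiplicative free_product G (free_group 'I_n) -> K}) w :
  MIF G -> f w != 1 ->
  exists2 h : {multiplicative free_product G (free_group 'I_n) -> G},
    forall g, h (free_product_inl _ g) = g & h w != 1.
Proof.
move=> mifG fw; apply: contrapT => nh.
have w1 : w = 1.
  by apply: mifG => h hi; case: (eqVneq (h w) 1) => // hw; case: nh; exists h.
by rewrite w1 hom1 eqxx in fw.
Qed.

(* The four commutators are fed to one mixed identity by nesting them in
   commutators twisted by three auxiliary variables. *)
Lemma MIF_conjugator (G : groupType) (g1 g2 : G) : MIF G ->
  g1 != 1 -> g2 != 1 ->
  exists x : G, forall a b, a \in [:: g1; g2] -> b \in [:: g1; g2] ->
    [~ a, b ^ x] != 1.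
Proof.
move=> mifG g1N1 g2N1.
(* Each overgroup is built over the preceding one, so that its conjugator is generic even for the
   commutators formed with the earlier conjugators. *)
have [K1 [f1 [t1 [inj1 c1]]]] := exists_generic_conjugator G.
have [K2 [f2 [t2 [inj2 c2]]]] := exists_generic_conjugator K1.
have [K3 [f3 [t3 [inj3 c3]]]] := exists_generic_conjugator K2.
have [K4 [f4 [t4 [inj4 c4]]]] := exists_generic_conjugator K3.
have injN1 (H K : groupType) (f : {multiplicative H -> K}) h :
    (forall g, f g = 1 -> g = 1) -> h != 1 -> f h != 1.
  by move=> inj; apply: contra_neq; exact: inj.
pose y (i : 'I_4) : K4 :=
  nth 1 [:: f4 (f3 (f2 t1)); f4 (f3 t2); f4 t3; t4] i.
have [f [fi fy]] := @free_product_lift G 4 K4 (f4 \o (f3 \o (f2 \o f1))) y.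
pose X k := @free_product_var G 4 (inord k).
pose c a b :=
  [~ free_product_inl (free_group 'I_4) a, free_product_inl _ b ^ X 0%N].
have cE (L : groupType) (q : {multiplicative _ -> L}) a b :
    q (c a b) =
      [~ q (free_product_inl _ a), q (free_product_inl _ b) ^ q (X 0%N)].
  by rewrite homR homJ.
clearbody c.
pose w := [~ [~ c g1 g1, c g1 g2 ^ X 1%N],
             [~ c g2 g1, c g2 g2 ^ X 2%N] ^ X 3%N].
pose C a b := [~ f1 a, f1 b ^ t1].
have fX k : (k < 4)%N ->
    f (X k) = nth 1 [:: f4 (f3 (f2 t1)); f4 (f3 t2); f4 t3; t4] k.
  by move=> k4; rewrite fy /y inordK.
have fc a b : f (c a b) = f4 (f3 (f2 (C a b))).
  by rewrite cE /C !homR !homJ !fi fX.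
have [|h hi hw] := @MIF_nontrivial_value G 4 K4 f w mifG.
  rewrite /w !(homR, homJ) !fc !fX //= -!homJ -!homR.
  by apply: c4; [apply: injN1 => //; apply: c2|apply: c3; apply: injN1 => //];
    exact: c1.
have hc a b : h (c a b) = [~ a, b ^ h (X 0%N)] by rewrite cE !hi.
exists (h (X 0%N)) => a b; rewrite !inE => ab bb; rewrite -hc.
apply: contraNneq hw; rewrite /w !(homR, homJ).
by case/orP: ab => /eqP ->; case/orP: bb => /eqP -> ->;
  rewrite ?(conj1g, comm1g, commg1).
Qed.

End MIFConjugator.
(** * Gromov products *)

Local Open Scope ring_scope.

Section GromovProduct.
Context {R : realType} {S : metricType R}.
Implicit Types (o p x y z : S).

Lemma gp_sym o x y : gromov_product o x y = gromov_product o y x.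
Proof. rewrite /gromov_product (metric_sym x y); lra. Qed.

Lemma gp_ge0 o x y : 0 <= gromov_product o x y.
Proof.
rewrite /gromov_product.
have := metric_triangle x o y; rewrite (metric_sym o y); lra.
Qed.

Lemma gp_le_dist o x y : gromov_product o x y <= mdist o x.
Proof.
rewrite /gromov_product.
have := metric_triangle o x y; rewrite (metric_sym o y) (metric_sym o x); lra.
Qed.

Lemma gp_self o x : gromov_product o x x = mdist o x.
Proof. rewrite /gromov_product mdistxx (metric_sym o x); lra. Qed.

Lemma gp_base o p x y :
  gromov_product o x y <= gromov_product p x y + mdist o p.
Proof.
rewrite /gromov_product.
have := metric_triangle x p o; have := metric_triangle y p o.
rewrite (metric_sym p o); lra.
Qed.

Lemma gp_move o x y z :
  gromov_product o x y <= gromov_product o z y + mdist x z.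
Proof.
rewrite /gromov_product.
have := metric_triangle x z o; have := metric_triangle z x y.
rewrite (metric_sym z x); lra.
Qed.

Lemma gp_flip o p x : gromov_product o p x = mdist o p - gromov_product p o x.
Proof.
rewrite /gromov_product (metric_sym p o) (metric_sym p x) (metric_sym o x); lra.
Qed.

(** Each of the four points occurs once with each sign, so the distances to the base point
    cancel. *)
Lemma gp_cross_ratio o p x y z t :
  gromov_product o x y + gromov_product o z t
    - gromov_product o x z - gromov_product o y t =
  gromov_product p x y + gromov_product p z t
    - gromov_product p x z - gromov_product p y t.
Proof. rewrite /gromov_product; lra. Qed.

End GromovProduct.

(** * Eventual bounds on Gromov products along sequences *)

Section SequenceProducts.
Context {R : realType} {S : metricType R}.
Implicit Types (o p : S) (r s : R) (x y z : nat -> S).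

(** Stands in for a bound on a lower limit, as [far] does for an upper limit; a constant sequence
    represents a point of [S]. *)
Definition near o r x y := exists N, forall i j,
  (N <= i)%N -> (N <= j)%N -> r <= gromov_product o (x i) (y j).

Definition far o r x y := exists N, forall i j,
  (N <= i)%N -> (N <= j)%N -> gromov_product o (x i) (y j) <= r.

Lemma near_sym o r x y : near o r x y -> near o r y x.
Proof. by move=> [N xy]; exists N => i j Ni Nj; rewrite gp_sym; apply: xy. Qed.

Lemma far_sym o r x y : far o r x y -> far o r y x.
Proof. by move=> [N xy]; exists N => i j Ni Nj; rewrite gp_sym; apply: xy. Qed.

Lemma near_le o r s x y : s <= r -> near o r x y -> near o s x y.
Proof.
by move=> sr [N xy]; exists N => i j Ni Nj; apply: le_trans sr _; apply: xy.
Qed.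

Lemma far_le o r s x y : r <= s -> far o r x y -> far o s x y.
Proof.
by move=> sr [N xy]; exists N => i j Ni Nj; apply: le_trans _ sr; apply: xy.
Qed.

Lemma near_base o p r x y : near o r x y -> near p (r - mdist o p) x y.
Proof.
move=> [N xy]; exists N => i j Ni Nj.
rewrite lerBlDr; exact: le_trans (xy i j Ni Nj) (gp_base _ _ _ _).
Qed.

Lemma near_far o r s x y : near o r x y -> far o s x y -> r <= s.
Proof.
move=> [N xy] [M yx].
by apply: le_trans (xy (maxn N M) (maxn N M) _ _) (yx _ _ _ _);
  rewrite ?leq_maxl ?leq_maxr.
Qed.

Lemma gromov_simP o x y : gromov_sim x y <-> forall r, near o r x y.
Proof.
split=> [xy r|xy p].
  have /cvgryPge/(_ r) := xy o.
  move=> [[P Q] [/= [N _ NP] [M _ MQ]] PQ].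
  exists (maxn N M) => i j; rewrite !geq_max => /andP[Ni _] /andP[_ Mj].
  by apply: (PQ (i, j)); split => /=; [exact: NP|exact: MQ].
apply/cvgryPge => r; have [N Nxy] := near_base p (xy (r + mdist o p)).
exists ([set i | (N <= i)%N], [set i | (N <= i)%N]) => /=.
  by split; exists N.
by move=> [i j] [/= Ni Nj]; have := Nxy i j Ni Nj; rewrite addrK.
Qed.

Lemma gromov_sim_sym x y : gromov_sim x y -> gromov_sim y x.
Proof.
move=> /(gromov_simP (x 0%N)) xy; apply/(gromov_simP (x 0%N)) => r.
exact: near_sym.
Qed.

End SequenceProducts.

(** * Consequences of the four-point inequality, and boundary points *)

Section Hyperbolicity.
Context {R : realType} {S : metricType R}.
Variable delta : R.
Hypothesis delta_ge0 : 0 <= delta.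
Hypothesis hyp : forall x y z o : S,
  Num.min (gromov_product o x z) (gromov_product o z y) - delta
    <= gromov_product o x y.
Implicit Types (o p q : S) (r s : R) (x y z u : nat -> S).

Lemma hyp_le o p q t r : r <= gromov_product o p q ->
  r <= gromov_product o q t -> r - delta <= gromov_product o p t.
Proof.
move=> pq qt; apply: le_trans (hyp p t q o).
by rewrite lerD2r le_min pq qt.
Qed.

Lemma hyp_lt o p q t r : r < gromov_product o p q ->
  r < gromov_product o q t -> r - delta < gromov_product o p t.
Proof.
move=> pq qt; apply: lt_le_trans (hyp p t q o).
by rewrite ltrD2r lt_min pq qt.
Qed.

Lemma near_trans o r x y z : near o r x z -> near o r z y ->
  near o (r - delta) x y.
Proof.
move=> [N xz] [M zy]; exists (maxn N M) => i j.
rewrite !geq_max => /andP[Ni Mi] /andP[Nj Mj].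
exact: hyp_le (xz _ _ Ni Nj) (zy _ _ Mj Mj).
Qed.

Lemma far_near o r s x y z : far o r x y -> near o s x z -> r + delta < s ->
  far o (r + delta) z y.
Proof.
move=> [N xy] [M xz] rs; exists (maxn N M) => i j.
rewrite !geq_max => /andP[Ni Mi] /andP[Nj Mj]; rewrite leNgt; apply/negP => zy.
set m := Num.min s (gromov_product o (z i) (y j)).
have rm : r + delta < m by rewrite lt_min rs zy.
have := @hyp_le o (x i) (z i) (y j) m.
rewrite !ge_min lexx orbT (xz _ _ Mi Mi) /= => /(_ isT isT) ?.
have := xy i j Ni Nj; lra.
Qed.

(* Common to sequences converging to a boundary point and constant sequences, so
   that points of [S] and of its boundary can be handled together. *)
Definition tight o x := forall r, exists N, forall i j p,
  (N <= i)%N -> (N <= j)%N -> r <= gromov_product o (x i) p ->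
  r - delta <= gromov_product o (x j) p.

Lemma gromov_tight o x : gromov_seq x -> tight o x.
Proof.
move=> /(gromov_simP o) xx r; have [N xN] := xx r.
by exists N => i j p Ni Nj; apply: hyp_le; exact: xN.
Qed.

Lemma cst_tight o p : tight o (fun=> p).
Proof. by move=> r; exists 0%N => i j q _ _ /= rp; have := delta_ge0; lra. Qed.

(** One late pair with product at least [r] passes this bound on to all late pairs, at the cost of
    one [delta] for each sequence. *)
Lemma far_or_near o r x y : tight o x -> tight o y ->
  far o r x y \/ near o (r - delta - delta) x y.
Proof.
move=> /(_ r)[N xN] /(_ (r - delta))[M yM].
have [[i [j [Ni [Mj rij]]]]|nxy] := pselect (exists i j,
  (N <= i)%N /\ (M <= j)%N /\ r <= gromov_product o (x i) (y j)).
  right; exists (maxn N M) => i' j'.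
  rewrite !geq_max => /andP[Ni' Mi'] /andP[Nj' Mj'].
  rewrite gp_sym; apply: (yM j) => //; rewrite gp_sym; exact: (xN i).
left; exists (maxn N M) => i j.
rewrite !geq_max => /andP[Ni Mi] /andP[Nj Mj]; rewrite leNgt; apply/negP => rij.
by apply: nxy; exists i, j; rewrite Ni Mj ltW.
Qed.

Lemma gromov_sim_trans x y z : gromov_sim x z -> gromov_sim z y ->
  gromov_sim x y.
Proof.
move=> /(gromov_simP (x 0%N)) xz /(gromov_simP (x 0%N)) zy.
apply/(gromov_simP (x 0%N)) => r; rewrite -(addrK delta r).
exact: near_trans (xz _) (zy _).
Qed.

Lemma not_sim_far o x y : gromov_seq x -> gromov_seq y -> ~ gromov_sim x y ->
  exists C, far o C x y.
Proof.
move=> xS yS nxy; apply: contrapT => nfar; apply: nxy.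
apply/(gromov_simP o) => r.
have [xy|] := @far_or_near o (r + delta + delta) x y (gromov_tight o xS)
  (gromov_tight o yS).
  by case: nfar; exists (r + delta + delta).
by rewrite !addrK.
Qed.

Lemma far_sim o r x x' y y' : far o r x y -> gromov_sim x x' ->
  gromov_sim y y' -> far o (r + delta + delta) x' y'.
Proof.
move=> xy /(gromov_simP o) xx' /(gromov_simP o) yy'; apply: far_sym.
have rd (t : R) : t < t + 1 by rewrite ltrDl.
apply: far_near (yy' (r + delta + delta + 1)) (rd _); apply: far_sym.
exact: far_near xy (xx' (r + delta + 1)) (rd _).
Qed.

Lemma near_sim o r x x' y y' : near o r x y -> gromov_sim x x' ->
  gromov_sim y y' -> near o (r - delta - delta) x' y'.
Proof.
move=> xy /gromov_sim_sym/(gromov_simP o) xx' /(gromov_simP o) yy'.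
apply: near_trans (near_trans (xx' _) xy) _; apply: near_le (yy' r).
have := delta_ge0; lra.
Qed.

(** The threshold for [u k] along [x] may depend on [k]: the intermediate term [x (maxn L M)] is
    late enough both for [u k] and for the products within [x]. *)
Lemma cst_near_sim o x u : gromov_seq x ->
  (forall r, exists N, forall k, (N <= k)%N -> near o r (fun=> u k) x) ->
  gromov_seq u /\ gromov_sim u x.
Proof.
move=> /(gromov_simP o) xx ux; have sim_ux : gromov_sim u x.
  apply/(gromov_simP o) => r; have [N uN] := ux (r + delta).
  have [M xM] := xx (r + delta); exists (maxn N M) => k j.
  rewrite !geq_max => /andP[Nk _] /andP[_ Mj]; have [L uL] := uN k Nk.
  rewrite -(addrK delta r); apply: (@hyp_le _ _ (x (maxn L M))).
    exact: (uL L _ _ (leq_maxl _ _)).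
  by apply: xM => //; exact: leq_maxr.
split=> //; exact: gromov_sim_trans (gromov_sim_sym sim_ux).
Qed.

Lemma bclass_gromov (a : boundary S) x : bclass a x -> gromov_seq x.
Proof. by have [y _ ->] := bclassP a; case. Qed.

Lemma bclass_nonempty (a : boundary S) : exists x, bclass a x.
Proof. by have [x xx ->] := bclassP a; exists x; split. Qed.

Lemma bclass_sim (a : boundary S) x y : bclass a x -> bclass a y ->
  gromov_sim x y.
Proof.
have [z _ ->] := bclassP a => -[xx zx] [yy zy].
exact: gromov_sim_trans (gromov_sim_sym zx) zy.
Qed.

Lemma bclass_closed (a : boundary S) x y : bclass a x -> gromov_seq y ->
  gromov_sim x y -> bclass a y.
Proof.
have [z _ ->] := bclassP a => -[xx zx] yy xy.
by split=> //; exact: gromov_sim_trans zx xy.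
Qed.

Lemma bclass_eqP (a b : boundary S) x y : bclass a x -> bclass b y ->
  gromov_sim x y <-> a = b.
Proof.
move=> ax byy; split=> [xy|ab]; last first.
  by apply: (@bclass_sim b) => //; rewrite -ab.
apply: boundary_inj; apply/seteqP; split=> z.
  move=> az; apply: (bclass_closed byy (bclass_gromov az)).
  apply: gromov_sim_trans (gromov_sim_sym xy) (bclass_sim ax az).
move=> bz; apply: (bclass_closed ax (bclass_gromov bz)).
exact: gromov_sim_trans xy (bclass_sim byy bz).
Qed.

(** * Actions of general type *)

Section Action.
Variables (G : groupType) (A : isom_action G S) (o : S).
Implicit Types (g h : G) (a b : boundary S).

Lemma gp_act g p q t :
  gromov_product (A g p) (A g q) (A g t) = gromov_product p q t.
Proof. by rewrite /gromov_product !act_isom. Qed.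

Lemma dist_actV g p : mdist p (A g^-1%g p) = mdist p (A g p).
Proof. by rewrite -(act_isom A g) actKV metric_sym. Qed.

Lemma near_act g p r x y : near p r x y ->
  near (A g p) r (A g \o x) (A g \o y).
Proof. by move=> [N xy]; exists N => i j Ni Nj; rewrite gp_act; exact: xy. Qed.

Lemma far_act g p r x y : far p r x y -> far (A g p) r (A g \o x) (A g \o y).
Proof. by move=> [N xy]; exists N => i j Ni Nj; rewrite gp_act; exact: xy. Qed.

Lemma sim_actV g x : gromov_sim x (A g \o x) -> gromov_sim x (A g^-1%g \o x).
Proof.
move=> /(gromov_sim_act A g^-1%g) xgx; apply: gromov_sim_sym.
rewrite (_ : A g^-1%g \o (A g \o x) = x) // in xgx.
by apply/funext => n /=; rewrite actK.
Qed.

Lemma bclass_act a x g : bclass a x -> bclass (boundary_act A g a) (A g \o x).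
Proof. by move=> ax; exists x. Qed.

Lemma boundary_act_fixP a x g : bclass a x ->
  boundary_act A g a = a <-> gromov_sim x (A g \o x).
Proof.
move=> ax; have gx := bclass_act g ax; split=> [e|].
  by apply: (bclass_eqP ax gx).2.
by move/(bclass_eqP ax gx).1.
Qed.

Lemma boundary_act1 a : boundary_act A 1%g a = a.
Proof.
have [x ax] := bclass_nonempty a; apply/(boundary_act_fixP 1%g ax).
rewrite (_ : A 1%g \o x = x); first exact: bclass_gromov ax.
by apply/funext => n /=; rewrite act1.
Qed.

Lemma boundary_actM g h a :
  boundary_act A (g * h)%g a = boundary_act A g (boundary_act A h a).
Proof.
have [x ax] := bclass_nonempty a.
apply/(bclass_eqP (bclass_act _ ax) (bclass_act _ (bclass_act _ ax))).
rewrite (_ : A (g * h)%g \o x = A g \o (A h \o x)).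
  exact: bclass_gromov (bclass_act _ (bclass_act _ ax)).
by apply/funext => n /=; rewrite actM.
Qed.

Lemma boundary_actK g a : boundary_act A g^-1%g (boundary_act A g a) = a.
Proof. by rewrite -boundary_actM mulVg boundary_act1. Qed.

Lemma boundary_actKV g a : boundary_act A g (boundary_act A g^-1%g a) = a.
Proof. by rewrite -boundary_actM mulgV boundary_act1. Qed.

Lemma limit_setP a :
  limit_set A a <-> exists h : nat -> G, bclass a (fun n => A (h n) o).
Proof.
split=> [[s [x [xs ax]]]|[h ah]]; last first.
  by exists o, (fun n => A (h n) o); split=> // n; exists (h n).
have /choice[h hx] : forall n, exists h, A h s = x n.
  by move=> n; have [h _ hx] := xs n; exists h.
exists h; have xx := bclass_gromov ax.
have [] := @cst_near_sim o x (fun n => A (h n) o) xx; last first.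
  by move=> hS hsim; apply: bclass_closed ax hS (gromov_sim_sym hsim).
move=> r; have /(gromov_simP o)/(_ (r + mdist s o))[N xN] := xx.
exists N => k Nk; exists N => _ j _ Nj.
have := gp_move o (x k) (x j) (A (h k) o); rewrite -{2}hx act_isom.
have := xN k j Nk Nj; lra.
Qed.

(* [G] has elements with the dynamics of large powers of a loxodromic element
   whose attracting and repelling points are represented by [x] and [y]. *)
Definition pulls x y := forall r, exists h : G,
  near o r (fun=> A h o) x /\ near o r (fun=> A h^-1%g o) y.

Lemma pulls_sym x y : pulls x y -> pulls y x.
Proof.
by move=> xy r; have [h [hx hy]] := xy r; exists h^-1%g; rewrite invgK.
Qed.

Lemma pulls_limit x a : (exists y, pulls x y) -> bclass a x -> limit_set A a.
Proof.
move=> [y xy] ax; apply/limit_setP.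
have /choice[h hx] : forall n : nat, exists h, near o n%:R (fun=> A h o) x.
  by move=> n; have [h [hx _]] := xy n%:R; exists h.
exists h.
have [|hS hsim] := @cst_near_sim o x (fun n => A (h n) o) (bclass_gromov ax).
  move=> r; exists (Num.trunc `|r|).+1 => k rk; apply: near_le (hx k).
  apply: le_trans (ler_norm r) _; apply/ltW.
  apply: lt_le_trans (truncnS_gt _) _.
  by rewrite ler_nat.
exact: bclass_closed ax hS (gromov_sim_sym hsim).
Qed.

(* Every [h] in [H] keeps [h o] within bounded distance of the line from [y] to
   [x], so that a distant [h o] lies in the direction of one end, and then
   [h^-1 o] lies in the direction of the other one. *)
Lemma unbounded_pulls (H : set G) x y : gromov_seq x -> gromov_seq y ->
  ~ gromov_sim x y ->
  (forall h, H h -> gromov_sim x (A h \o x) /\ gromov_sim y (A h \o y)) ->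
  unbounded_orbits A H -> pulls x y.
Proof.
move=> xx yy nxy fixH unbH T.
have [C farC] := not_sim_far o xx yy nxy.
(* If, seen from [A g o], both ends had product at least [K - delta *+ 2] with [o], their mutual
   product would be at least [K - delta *+ 3], above the bound [C + delta *+ 2] for the translated
   pair. *)
pose K := C + delta *+ 5 + 1.
have [h Hh big] : exists2 h, H h &
    Num.max (T + K) (K + K + delta + 1) < mdist o (A h o).
  apply: contrapT => nbig; apply: (unbH o).
  exists (Num.max (T + K) (K + K + delta + 1) *+ 2) => _ _ [g Hg <-] [h Hh <-].
  have le g' : H g' -> mdist o (A g' o) <= Num.max (T + K) (K + K + delta + 1).
    by move=> Hg'; rewrite leNgt; apply/negP => ?; apply: nbig; exists g'.
  have := metric_triangle (A g o) o (A h o); have := le g Hg; have := le h Hh.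
  rewrite (metric_sym (A g o) o) mulr2n; lra.
have dichotomy g : gromov_sim x (A g \o x) -> gromov_sim y (A g \o y) ->
    far (A g o) K (fun=> o) x \/ far (A g o) K (fun=> o) y.
  move=> gx gy.
  have farg := far_sim (far_act g farC) (gromov_sim_sym gx) (gromov_sim_sym gy).
  have [|nx] := far_or_near K (cst_tight (A g o) o) (gromov_tight (A g o) xx).
    by left.
  have [|ny] := far_or_near K (cst_tight (A g o) o) (gromov_tight (A g o) yy).
    by right.
  have := near_far (near_trans (near_sym nx) ny) farg; rewrite /K; lra.
have far_nearK g z : far (A g o) K (fun=> o) z ->
    near o (mdist o (A g o) - K) (fun=> A g o) z.
  move=> [N gz]; exists N => i j Ni Nj; rewrite gp_flip.
  have := gz i j Ni Nj; lra.
(* If [g o] lies towards [z], then [g^-1 o] does not: translating [farz] by [g^-1], which preserves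
   the class of [z], bounds the product of [g^-1 o] and [z]. *)
have core g z z' : gromov_sim z (A g \o z) ->
    mdist o (A g o) = mdist o (A h o) ->
    far (A g o) K (fun=> o) z ->
    far (A g^-1%g o) K (fun=> o) z \/ far (A g^-1%g o) K (fun=> o) z' ->
    near o T (fun=> A g o) z /\ near o T (fun=> A g^-1%g o) z'.
  move=> gz dg farz farV; move: big; rewrite gt_max -dg => /andP[big1 big2].
  split; first by apply: near_le (far_nearK _ _ farz); lra.
  case: farV => [/far_nearK|/far_nearK]; last first.
    by rewrite dist_actV; apply: near_le; lra.
  rewrite dist_actV => nearV.
  have far1 : far o K (fun=> A g^-1%g o) (A g^-1%g \o z).
    by have := far_act g^-1%g farz; rewrite actK.
  have /gromov_sim_sym/(gromov_simP o)/(_ (K + delta + 1)) near1 := sim_actV gz.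
  have lt1 : K + delta < K + delta + 1 by rewrite ltrDl.
  have := near_far nearV (far_sym (far_near (far_sym far1) near1 lt1)); lra.
have [hx hy] := fixH h Hh; have [hVx hVy] := (sim_actV hx, sim_actV hy).
have [farx|fary] := dichotomy h hx hy.
  by exists h; apply: core => //; exact: dichotomy.
have farV : far (A h^-1%g o) K (fun=> o) y \/ far (A h^-1%g o) K (fun=> o) x.
  by have [] := dichotomy h^-1%g hVx hVy; [right|left].
have [ny nx] := core h y x hy erefl fary farV.
by exists h^-1%g; rewrite invgK.
Qed.

Lemma far_near2 r s x x' y y' : far o r x y -> near o s x' x ->
  near o s y' y -> r + delta + delta < s -> far o (r + delta + delta) x' y'.
Proof.
move=> xy xx' yy' rs; have rs' : r + delta < s by have := delta_ge0; lra.
apply: far_sym; apply: far_near (near_sym yy') rs; apply: far_sym.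
exact: far_near xy (near_sym xx') rs'.
Qed.

Lemma loxodromic_pulls g : loxodromic A g -> exists a b, [/\ a <> b,
  boundary_act A g a = a, boundary_act A g b = b &
  exists x y, [/\ bclass a x, bclass b y & pulls x y]].
Proof.
move=> [unb [a [b [ab fixab]]]].
have fix_of c : [set a; b] c -> forall h, cyclic_subgroup g h ->
    boundary_act A h c = c by rewrite -fixab.
have cg : cyclic_subgroup g g by exists 1%N; left.
have fa := fix_of a (or_introl erefl); have fb := fix_of b (or_intror erefl).
exists a, b; split=> //; [exact: fa|exact: fb|].
have [x ax] := bclass_nonempty a; have [y byy] := bclass_nonempty b.
exists x, y; split=> //; apply: unbounded_pulls unb.
- exact: bclass_gromov ax.
- exact: bclass_gromov byy.
- by move/(bclass_eqP ax byy).
- move=> h Hh; split.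
    by apply/(boundary_act_fixP h ax); exact: fa.
  by apply/(boundary_act_fixP h byy); exact: fb.
Qed.

(** * Limit points of an action of general type *)

Hypothesis gt : general_type A.

Lemma general_type_pulls : exists (a b c d : boundary S) x y z w,
  [/\ [/\ a <> b, a <> c, a <> d, b <> c & b <> d],
      [/\ bclass a x, bclass b y, bclass c z & bclass d w],
      pulls x y & pulls z w].
Proof.
have [_ [g [h [/loxodromic_pulls[a [b [ab ga gb [x [y [ax byy xy]]]]]]
  /loxodromic_pulls[c [d [cd hc hd [z [w [cz dw zw]]]]]] gh0]]]] := gt.
have disj e : boundary_act A g e = e -> boundary_act A h e = e -> False.
  move=> ge he; have : (boundary_fix A [set g] `&` boundary_fix A [set h]) e.
    by split=> k ->.
  by rewrite gh0.
exists a, b, c, d, x, y, z, w; split=> //.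
by split=> // e;
  [apply: (disj a)|apply: (disj a)|apply: (disj b)|apply: (disj b)];
  rewrite ?ga ?gb // e.
Qed.

Lemma limit_points3 : exists c1 c2 c3 : boundary S,
  [/\ limit_set A c1, limit_set A c2 & limit_set A c3] /\
  [/\ c1 <> c2, c1 <> c3 & c2 <> c3].
Proof.
have [a [b [c [d [x [y [z [w [[ab ac _ bc _] [ax byy cz _] xy zw]]]]]]]]] :=
  general_type_pulls.
exists a, b, c; split=> //; split.
- by apply: pulls_limit ax; exists y.
- by apply: pulls_limit byy; exists x; exact: pulls_sym.
- by apply: pulls_limit cz; exists w.
Qed.

Lemma bclass_far a b x y : bclass a x -> bclass b y -> a <> b ->
  exists C, far o C x y.
Proof.
move=> ax byy ab; apply: not_sim_far (bclass_gromov ax) (bclass_gromov byy) _.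
by move/(bclass_eqP ax byy).
Qed.

Lemma common_index3 (P Q : pred nat) :
  (forall i j, i < 3 -> j < 3 -> P i -> P j -> i = j)%N ->
  (forall i j, i < 3 -> j < 3 -> Q i -> Q j -> i = j)%N ->
  exists i, [&& (i < 3)%N, ~~ P i & ~~ Q i].
Proof.
move=> P1 Q1; apply: contrapT => nPQ.
have PQ i : (i < 3)%N -> P i || Q i.
  move=> i3; apply: contraPT nPQ; rewrite negb_or => nPQi; apply.
  by exists i; rewrite i3.
have := (PQ 0%N isT, PQ 1%N isT, PQ 2%N isT).
have := (P1 0%N 1%N isT isT, P1 0%N 2%N isT isT, P1 1%N 2%N isT isT).
have := (Q1 0%N 1%N isT isT, Q1 0%N 2%N isT isT, Q1 1%N 2%N isT isT).
case: (P 0%N) (P 1%N) (P 2%N) (Q 0%N) (Q 1%N) (Q 2%N) => [] [] [] [] [] [] /=;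
  by move=> [[q01 q02] q12] [[p01 p02] p12] [[pq0 pq1] pq2];
  try done; try (by have := p01 isT isT); try (by have := p02 isT isT);
  try (by have := p12 isT isT); try (by have := q01 isT isT);
  try (by have := q02 isT isT); try (by have := q12 isT isT).
Qed.

Lemma separated3 (K : R) (P : nat -> S) :
  gromov_product o (P 0%N) (P 1%N) <= K ->
  gromov_product o (P 0%N) (P 2%N) <= K ->
  gromov_product o (P 1%N) (P 2%N) <= K ->
  forall i j, (i < 3)%N -> (j < 3)%N ->
    K < gromov_product o (P i) (P j) -> i = j.
Proof.
rewrite !leNgt => n01 n02 n12.
move=> [|[|[|//]]] [|[|[|//]]] _ _ //; rewrite 1?gp_sym => lt;
  by [rewrite lt in n01|rewrite lt in n02|rewrite lt in n12
     |rewrite gp_sym lt in n01|rewrite gp_sym lt in n02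
     |rewrite gp_sym lt in n12].
Qed.

(* Two of the three elements [h], [h^-1], [k] send [q] in the direction of their
   attracting point; [p] lies in at most one of these two directions. *)
Lemma extension : exists C D, forall p q : S, exists f : G,
  mdist o (A f o) <= D /\ gromov_product o p (A f q) <= C.
Proof.
have [a [b [c [d [x [y [z [w [[ab ac ad bc bd] [ax byy cz dw] xy zw]]]]]]]]] :=
  general_type_pulls.
have [C1 f1] := bclass_far ax byy ab; have [C2 f2] := bclass_far ax cz ac.
have [C3 f3] := bclass_far byy cz bc; have [C4 f4] := bclass_far byy dw bd.
have [C5 f5] := bclass_far ax dw ad.
pose C := Num.max C1 (Num.max C2 (Num.max C3 (Num.max C4 C5))).
have le1 : C1 <= C by rewrite /C !le_max lexx.
have le2 : C2 <= C by rewrite /C !le_max lexx ?orbT.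
have le3 : C3 <= C by rewrite /C !le_max lexx ?orbT.
have le4 : C4 <= C by rewrite /C !le_max lexx ?orbT.
have le5 : C5 <= C by rewrite /C !le_max lexx ?orbT.
move: (far_le le1 f1) (far_le le2 f2) (far_le le3 f3) (far_le le4 f4)
  (far_le le5 f5) => {le1 le2 le3 le4 le5 f1 f2 f3 f4 f5} f1 f2 f3 f4 f5.
(* [K] bounds the product of two points that are near to separated ends. [T] makes the product of
   [F i o] and [F i q] exceed [K + delta *+ 2] when [q] avoids the repelling direction. *)
pose K := C + delta + delta; pose T := K + K + delta *+ 4 + 1.
have KT : C + delta + delta < T.
  have := delta_ge0; have [N /(_ N N (leqnn N) (leqnn N))] := f1.
  have := gp_ge0 o (x N) (y N); rewrite /T /K; lra.
have sep p q u v : near o T (fun=> p) u -> near o T (fun=> q) v ->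
    far o C u v -> gromov_product o p q <= K.
  move=> pu qv uv; have [N] := far_near2 uv pu qv KT.
  exact: (fun H => H N N (leqnn N) (leqnn N)).
have [h [hx hy]] := xy T; have [k [kz kw]] := zw T.
pose F (i : nat) := match i with 0 => h | 1 => h^-1%g | _ => k end.
have sepF : forall i j, (i < 3)%N -> (j < 3)%N ->
    K < gromov_product o (A (F i) o) (A (F j) o) -> i = j.
  apply: (@separated3 K (fun i => A (F i) o)).
  - exact: sep hx hy f1.
  - exact: sep hx kz f2.
  - exact: sep hy kz f3.
have sepV : forall i j, (i < 3)%N -> (j < 3)%N ->
    K < gromov_product o (A (F i)^-1%g o) (A (F j)^-1%g o) -> i = j.
  apply: (@separated3 K (fun i => A (F i)^-1%g o)); rewrite /F /= ?invgK.
  - by rewrite gp_sym; exact: sep hx hy f1.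
  - exact: sep hy kw f4.
  - exact: sep hx kw f5.
have big i : T <= mdist o (A (F i) o).
  have far0 u p : near o T (fun=> p) u -> T <= mdist o p.
    move=> [N /(_ N N (leqnn N) (leqnn N))] /le_trans; apply.
    exact: gp_le_dist.
  by case: i => [|[|i]] /=; [exact: far0 hx|exact: far0 hy|exact: far0 kz].
exists (K + delta *+ 2), (mdist o (A h o) + mdist o (A k o)) => p q.
(* [bad1] places [q] in the repelling direction of [F i], and [bad2] forces [p] into its attracting
   direction; each holds for at most one of the three indices. *)
pose bad1 i := K + delta < gromov_product o (A (F i)^-1%g o) q.
pose bad2 i := ~~ bad1 i && (K + delta *+ 2 < gromov_product o p (A (F i) q)).
have [i j i3 j3|i j i3 j3|i /and3P[i3 nb1]] := @common_index3 bad1 bad2.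
- rewrite /bad1 => bi bj; apply: sepV => //; rewrite -(addrK delta K).
  by apply: (hyp_lt bi); rewrite gp_sym.
- have close k' : bad2 k' -> K + delta < gromov_product o p (A (F k') o).
    rewrite /bad2 /bad1 -leNgt => /andP[nb b2].
    have -> : K + delta = K + delta *+ 2 - delta by rewrite mulr2n addrA addrK.
    apply: (hyp_lt b2); rewrite gp_sym gp_flip.
    have := gp_act (F k') o (A (F k')^-1%g o) q; rewrite actKV => ->.
    have := big k'; have := delta_ge0; rewrite /T; lra.
  move=> /close bi /close bj; apply: sepF => //; rewrite -(addrK delta K).
  by apply: (hyp_lt _ bj); rewrite gp_sym.
rewrite /bad2 nb1 /= -leNgt => le2; exists (F i); split=> //.
have := mdist_ge0 o (A h o); have := mdist_ge0 o (A k o).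
case: (i) => [|[|m]] /=; rewrite ?dist_actV; lra.
Qed.

(** The hypothesis puts [u n] in the shadow of [x n] seen from [o], and these shadows shrink to the
    limit of [x]. *)
Lemma shadow_sim x u C : gromov_seq x ->
  (forall n, mdist o (x n) - C <= gromov_product o (u n) (x n)) ->
  gromov_seq u /\ gromov_sim u x.
Proof.
move=> xx ux; apply: (@cst_near_sim o) => // r.
have /(gromov_simP o)/(_ (r + delta + `|C|))[N xN] := xx.
exists N => k Nk; exists N => _ j _ Nj; rewrite -(addrK delta r).
have nC := ler_norm C; have nC0 := normr_ge0 C.
apply: (@hyp_le o _ (x k)); last by have := xN k j Nk Nj; lra.
have := ux k; have := xN k k Nk Nk; rewrite gp_self; lra.
Qed.

(** A bounded [f n] inserted between [h n] and the inverse of [k n] prevents backtracking: the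
    product sends [o] into the shadow of [h n o], and its inverse sends [o] into that of [k n o]. *)
Lemma double_limit a b : limit_set A a -> limit_set A b ->
  exists h : nat -> G, bclass a (fun n => A (h n) o) /\
    bclass b (fun n => A (h n)^-1%g o).
Proof.
move=> /limit_setP[h ah] /limit_setP[k bk]; have [C [D ext]] := extension.
have /choice[f fP] : forall n, exists f, mdist o (A f o) <= D /\
    gromov_product o (A (h n)^-1%g o) (A f (A (k n)^-1%g o)) <= C.
  by move=> n; exact: ext.
exists (fun n => h n * f n * (k n)^-1)%g.
have [|S1 sim1] := @shadow_sim _ (fun n => A (h n * f n * (k n)^-1)%g o) C
    (bclass_gromov ah).
  move=> n; rewrite gp_sym gp_flip lerD2l lerN2; have [_] := fP n.
  by rewrite -[X in X <= _ -> _](gp_act (h n)) actKV !actM gp_sym.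
have [|S2 sim2] := @shadow_sim _ (fun n => A (h n * f n * (k n)^-1)^-1%g o)
    (C + D) (bclass_gromov bk).
  move=> n; rewrite gp_sym gp_flip lerD2l lerN2; have [fD fC] := fP n.
  rewrite !invgM invgK !actM -[X in X <= _](gp_act (k n)^-1%g) !actK.
  rewrite -[X in X <= _](gp_act (f n)) actKV gp_sym.
  apply: le_trans (gp_base _ o _ _) _; rewrite metric_sym; lra.
split; [exact: bclass_closed ah S1 (gromov_sim_sym sim1)
       |exact: bclass_closed bk S2 (gromov_sim_sym sim2)].
Qed.

(** Lies between the strict and the weak inequality of [r] with [boundary_product o a b], without
    lower limits. *)
Definition nearb r a b := forall x y, bclass a x -> bclass b y -> near o r x y.

Lemma nearb_le r s a b : s <= r -> nearb r a b -> nearb s a b.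
Proof. by move=> sr ab x y ax byy; apply: near_le sr (ab _ _ ax byy). Qed.

Lemma near_nearb r a b x y : bclass a x -> bclass b y -> near o r x y ->
  nearb (r - delta - delta) a b.
Proof.
move=> ax byy xy x' y' ax' byy'.
exact: near_sim xy (bclass_sim ax ax') (bclass_sim byy byy').
Qed.

Lemma nearb_trans r a b c : nearb r a c -> nearb r c b -> nearb (r - delta) a b.
Proof.
move=> ac cb x y ax byy; have [z cz] := bclass_nonempty c.
exact: near_trans (ac _ _ ax cz) (cb _ _ cz byy).
Qed.

Lemma nearb_self r a : nearb r a a.
Proof. by move=> x y ax ay; have /(gromov_simP o) := bclass_sim ax ay. Qed.

Lemma nearb_bounded a b : a <> b -> exists r, ~ nearb r a b.
Proof.
move=> ab; have [x ax] := bclass_nonempty a; have [y byy] := bclass_nonempty b.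
have [C xy] := bclass_far ax byy ab; exists (C + 1) => /(_ _ _ ax byy) nxy.
by have := near_far nxy xy; rewrite gerDl ler10.
Qed.

(* Far along an orbit sequence converging to [a], translates of two of three
   given limit points are close to [a], and one of them differs from [a]. *)
Lemma limit_perfect a r : limit_set A a ->
  exists b, [/\ limit_set A b, b <> a & nearb r a b].
Proof.
move=> la; have /limit_setP[h ah] := la.
have [c1 [c2 [c3 [[l1 l2 l3] [c12 c13 c23]]]]] := limit_points3.
have [y1 cy1] := bclass_nonempty c1; have [y2 cy2] := bclass_nonempty c2.
have [y3 cy3] := bclass_nonempty c3.
have [C1 f12] := bclass_far cy1 cy2 c12.
have [C2 f13] := bclass_far cy1 cy3 c13.
have [C3 f23] := bclass_far cy2 cy3 c23.
(* Two of the three points in the direction of [p] would have product at least [K - delta *+ 3],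
   above their bound; [T] absorbs [K] and the three [delta] lost in [push]. *)
pose K := `|C1| + `|C2| + `|C3| + delta *+ 3 + 1.
pose T := r + K + delta *+ 3.
have /(gromov_simP o)/(_ T)[N xN] := bclass_gromov ah.
pose g := h N; pose p := A g^-1%g o.
have n1 := ler_norm C1; have n2 := ler_norm C2; have n3 := ler_norm C3.
have p1 := normr_ge0 C1; have p2 := normr_ge0 C2; have p3 := normr_ge0 C3.
have two u v C : gromov_seq u -> gromov_seq v -> far o C u v ->
    C <= `|C1| + `|C2| + `|C3| -> far o K (fun=> p) u \/ far o K (fun=> p) v.
  move=> us vs uv CK.
  have [|nu] := far_or_near K (cst_tight o p) (gromov_tight o us).
    by left.
  have [|nv] := far_or_near K (cst_tight o p) (gromov_tight o vs).
    by right.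
  have := near_far (near_trans (near_sym nu) nv) uv; rewrite /K; lra.
have push c u : bclass c u -> far o K (fun=> p) u ->
    nearb r a (boundary_act A g c).
  move=> cu far_u.
  have gu : near o (T - K) (fun=> A g o) (A g \o u).
    have := far_act g far_u; rewrite (_ : A g \o _ = fun=> o); last first.
      by apply/funext => ?; rewrite /p /= actKV.
    move=> [M Mfar]; exists M => i j Mi Mj; rewrite gp_flip.
    have := Mfar i j Mi Mj; have := xN N N (leqnn N) (leqnn N).
    rewrite gp_self /g; lra.
  have ga : near o (T - K) (fun n => A (h n) o) (fun=> A g o).
    exists N => i j Ni _; apply: le_trans (xN i N Ni (leqnn N)).
    rewrite gerBl /K; have := delta_ge0; lra.
  have := near_nearb ah (bclass_act g cu) (near_trans ga gu).
  apply: nearb_le; rewrite /T; lra.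
have [c [c' [lc lc' cc' nc nc']]] : exists c c',
    [/\ limit_set A c, limit_set A c', c <> c', nearb r a (boundary_act A g c)
      & nearb r a (boundary_act A g c')].
  have [s1 s2 s3] := And3 (bclass_gromov cy1) (bclass_gromov cy2)
    (bclass_gromov cy3).
  have [v1|v1] := two _ _ _ s1 s2 f12 ltac:(lra).
    have [v2|v2] := two _ _ _ s2 s3 f23 ltac:(lra).
      by exists c1, c2; split=> //; [exact: push v1|exact: push v2].
    by exists c1, c3; split=> //; [exact: push v1|exact: push v2].
  have [v2|v2] := two _ _ _ s1 s3 f13 ltac:(lra).
    by exists c1, c2; split=> //; [exact: push v2|exact: push v1].
  by exists c2, c3; split=> //; [exact: push v1|exact: push v2].
have [e|] := pselect (boundary_act A g c = a); last first.
  by move=> ne; exists (boundary_act A g c); split=> //; exact: limit_set_act.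
exists (boundary_act A g c'); split=> //; first exact: limit_set_act.
rewrite -e => /(congr1 (boundary_act A g^-1%g)).
by rewrite !boundary_actK => /esym.
Qed.

(** Each new point is taken closer to [a] than all earlier ones, which excludes repetitions. *)
Lemma limit_many a r n : limit_set A a -> exists s : seq (boundary S),
  [/\ size s = n, uniq s & forall b, b \in s ->
    [/\ limit_set A b, b <> a & nearb r a b]].
Proof.
move=> la; elim: n => [|n [s [sn us sP]]]; first by exists [::].
have [T sT] : exists T, forall b, b \in s -> ~ nearb T a b.
  elim: s {sn us} sP => [|b s IHs] sP; first by exists 0.
  have [|T sT] := IHs; first by move=> c cs; apply: sP; rewrite inE cs orbT.
  have [_ ba _] := sP b (mem_head b s).
  have [T' bT] := nearb_bounded (fun e => ba (esym e)).
  exists (Num.max T T') => c; rewrite inE => /predU1P[->|cs] nc.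
    by apply: bT; apply: nearb_le nc; rewrite le_max lexx orbT.
  by apply: (sT c cs); apply: nearb_le nc; rewrite le_max lexx.
have [b [lb ba nb]] := limit_perfect (Num.max T r) la.
exists (b :: s); split=> [|/=|c]; first by rewrite /= sn.
  rewrite us andbT; apply/negP => /sT; apply; apply: nearb_le nb.
  by rewrite le_max lexx.
rewrite inE => /predU1P[->|/sP //]; split=> //.
by apply: nearb_le nb; rewrite le_max lexx orbT.
Qed.

(** If [c = g b] and both [b] and [c] were near [a], then [g b] would be near [a] and near [g a],
    although the product of [a] and [g a] is bounded. *)
Lemma nearb_moved a g : boundary_act A g a <> a ->
  exists r, forall b c, nearb r a b -> nearb r a c -> boundary_act A g b <> c.
Proof.
move=> ga; have [x ax] := bclass_nonempty a.
have [C fC] := bclass_far ax (bclass_act g ax) (fun e => ga (esym e)).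
exists (C + delta *+ 3 + mdist o (A g o) + 1) => b c nb nc gbc.
have [y byy] := bclass_nonempty b; have gy := bclass_act g byy.
rewrite gbc in gy; have n1 := nc _ _ ax gy.
have := near_base o (near_act g (nb _ _ ax byy)); rewrite metric_sym => n2.
have d0 := mdist_ge0 o (A g o).
have := near_far (near_trans (near_le _ n1) (near_sym n2)) fC.
have := delta_ge0 => ? /(_ ltac:(lra)); lra.
Qed.

Lemma lt_product_nearb r a b :
  (r%:E < boundary_product o a b)%E -> nearb r a b.
Proof.
move=> rab x y ax byy.
have : (r%:E < limf_einf (fun ij : nat * nat =>
    (gromov_product o (x ij.1) (y ij.2))%:E) (filter_prod \oo \oo))%E.
  apply: lt_le_trans rab _; apply: ereal_inf_lbound.
  by exists x, y.
rewrite limf_einfE.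
move=> /ereal_sup_gt[_ [V [[P Q] [/= [N _ NP] [M _ MQ]] PQV] <-]] rV.
exists (maxn N M) => i j; rewrite !geq_max => /andP[Ni _] /andP[_ Mj].
rewrite -lee_fin; apply: le_trans (ltW rV) _; apply: ereal_inf_lbound.
exists (i, j) => //; apply: PQV; split=> /=; [exact: NP|exact: MQ].
Qed.

Lemma nearb_le_product r a b :
  nearb r a b -> (r%:E <= boundary_product o a b)%E.
Proof.
move=> nab; apply: le_ereal_inf_tmp => _ [x [y [ax byy ->]]].
have [N xy] := nab x y ax byy; rewrite limf_einfE.
apply: le_trans; last first.
  apply: ereal_sup_ubound.
  exists [set ij | (N <= ij.1)%N /\ (N <= ij.2)%N] => //.
  exists ([set i | (N <= i)%N], [set i | (N <= i)%N]) => //=.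
  by split; exists N.
apply: le_ereal_inf_tmp => _ [[i j] [/= Ni Nj] <-].
by rewrite lee_fin; exact: xy.
Qed.

End Action.

Lemma nearb_base o p r (a b : boundary S) :
  nearb o r a b -> nearb p (r - mdist o p) a b.
Proof. by move=> ab x y ax byy; apply/near_base/ab. Qed.

(** * The topology of the limit set in terms of Gromov products *)

Section LimitTopology.
Variables (G : groupType) (A : isom_action G S) (o : S).

(** The points [c] with [nearb o r a c] need not form an open set; those having a whole neighborhood
    among them do, since [nearb] is transitive up to [delta]. *)
Lemma boundary_open_near_core r (a : boundary S) :
  boundary_open [set b : boundary S | exists s, forall c,
    nearb o s b c -> nearb o r a c].
Proof.
move=> b [s sU] p.
exists (Num.max 0 (s + delta + mdist p o)); first by rewrite le_max lexx.
move=> c /lt_product_nearb /(nearb_base o) nbc.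
exists (s + delta) => e nce; apply: sU; rewrite -(addrK delta s).
apply: nearb_trans nce; apply: nearb_le nbc.
by rewrite lerBrDr le_max lexx orbT.
Qed.

Lemma interior_limitP (F : set (limit_set A)) (a : limit_set A) :
  interior F a <-> exists r, forall b : limit_set A,
    nearb o r (set_val a) (set_val b) -> F b.
Proof.
rewrite /interior nbhsE; split.
  move=> -[_ [[U Uop <-] /= Ua] UF].
  have [r r0 rU] := Uop (set_val a) Ua o; exists (r + 1) => b nab.
  apply: UF => /=; apply: rU => /=; apply: lt_le_trans (nearb_le_product nab).
  by rewrite lte_fin ltrDl.
move=> [r rF]; pose U := [set b : boundary S | exists s, forall c,
  nearb o s b c -> nearb o r (set_val a) c].
exists (set_val @^-1` U) => [|b [s]]; last first.
  by move/(_ (set_val b) (@nearb_self o s (set_val b))); exact: rF.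
split; last by exists r.
by exists U => //; exact: boundary_open_near_core.
Qed.

End LimitTopology.

(** * Ping-pong and supports *)

Section PingPong.
Variables (G : groupType) (A : isom_action G S) (o : S).
Hypothesis gt : general_type A.

(** Finitely many dense open sets meet: near a point moved by the earlier elements, topological
    freeness gives one moved by [g], and a smaller neighborhood keeps all of them moving. *)
Lemma topologically_free_moved (gs : seq G) :
  topologically_free (limit_act A) -> (forall g, g \in gs -> g <> 1%g) ->
  exists2 a, limit_set A a & forall g, g \in gs -> boundary_act A g a <> a.
Proof.
move=> tf gsN1; suff [a [la [r ar]]] : exists a, limit_set A a /\ exists r,
    forall b, nearb o r a b -> forall g, g \in gs -> boundary_act A g b <> b.
  by exists a => //; apply: ar; exact: nearb_self.
elim: gs gsN1 => [|g gs IHgs] gsN1.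
  have [c [_ [_ [[lc _ _] _]]]] := limit_points3 o gt.
  by exists c; split=> //; exists 0.
have [|a [la [r ar]]] := IHgs.
  by move=> h hgs; apply: gsN1; rewrite inE hgs orbT.
have [b [lb nb gb]] : exists b, [/\ limit_set A b, nearb o (r + delta) a b &
    boundary_act A g b <> b].
  apply: contrapT => nex; have gN1 := gsN1 g (mem_head _ _).
  pose a' : limit_set A := exist (fun b => b \in limit_set A) a (mem_set la).
  suff : interior [set x : limit_set A | limit_act A g x = x] a' by rewrite tf.
  apply/(interior_limitP o); exists (r + delta) => b nab.
  apply: contrapT => gb; apply: nex; exists (set_val b); split=> //.
    exact: set_mem (valP b).
  by move=> e; apply: gb; apply: val_inj.
exists b; split=> //; have [s bs] := nearb_moved o gb.
exists (Num.max s (r + delta)) => c nc h; rewrite inE => /predU1P[->|hgs].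
  by apply: bs; apply: nearb_le nc; rewrite le_max lexx.
apply: ar hgs; rewrite -(addrK delta r); apply: nearb_trans nb _.
by apply: nearb_le nc; rewrite le_max lexx orbT.
Qed.

Lemma uniform_bound (I : eqType) (l : seq I) (P : I -> R -> nat -> Prop) :
  (forall i C C' N N', C <= C' -> (N <= N')%N -> P i C N -> P i C' N') ->
  (forall i, i \in l -> exists C N, P i C N) ->
  exists C N, forall i, i \in l -> P i C N.
Proof.
move=> Pmono; elim: l => [|i l IHl] lP; first by exists 0, 0%N.
have [|C [N CN]] := IHl; first by move=> j jl; apply: lP; rewrite inE jl orbT.
have [C' [N' CN']] := lP i (mem_head i l).
exists (Num.max C C'), (maxn N N') => j; rewrite inE => /predU1P[->|jl].
  by apply: Pmono CN'; [rewrite le_max lexx orbT|exact: leq_maxr].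
by apply: Pmono (CN j jl); [rewrite le_max lexx|exact: leq_maxl].
Qed.

(* [C] does not depend on [L]: the [X i] are taken arbitrarily far along fixed
   sequences converging to distinct limit points close to [a]. *)
Lemma ping_pong_elements (gs : seq G) a n : limit_set A a ->
  (forall g, g \in gs -> boundary_act A g a <> a) ->
  exists C, forall L, exists X : 'I_n -> G,
    (forall i, L <= mdist o (A (X i) o)) /\
    forall (s t : 'I_n * bool) g,
      (g \in gs) || (g == 1%g) && (t != (s.1, ~~ s.2)) ->
      gromov_product o (A (letter_eval X s)^-1%g o)
        (A g (A (letter_eval X t) o)) <= C.
Proof.
move=> la gsa.
have [r gsr] : exists r, forall g, g \in gs -> forall b c,
    nearb o r a b -> nearb o r a c -> boundary_act A g b <> c.
  have [||r [_ rP]] := @uniform_bound _ gs (fun g r _ => forall b c,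
      nearb o r a b -> nearb o r a c -> boundary_act A g b <> c).
  - by move=> g C C' _ _ CC' _ H b c nb nc; apply: H; exact: nearb_le CC' _.
  - by move=> g /gsa /(nearb_moved o)[r]; exists r, 0%N.
  - by exists r.
have [pts [pts_size pts_uniq ptsP]] :=
  limit_many o gt r #|{: 'I_n * bool}| la.
pose pt (s : 'I_n * bool) := nth a pts (enum_rank s).
have pt_in (s : 'I_n * bool) : pt s \in pts by apply: mem_nth; rewrite pts_size.
have pt_inj (s t : 'I_n * bool) : pt s = pt t -> s = t.
  move=> /eqP; rewrite nth_uniq ?pts_size // => /eqP /val_inj.
  exact: enum_rank_inj.
have /choice[Y YP] : forall i : 'I_n, exists h : nat -> G,
    bclass (pt (i, true)) (fun k => A (h k) o) /\
    bclass (pt (i, false)) (fun k => A (h k)^-1%g o).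
  by move=> i; have [lt _ _] := ptsP _ (pt_in (i, true));
    have [lf _ _] := ptsP _ (pt_in (i, false)); exact: double_limit.
pose lY k (s : 'I_n * bool) := letter_eval (fun i => Y i k) s.
have lYP (s : 'I_n * bool) : bclass (pt s) (fun k => A (lY k s) o).
  by case: s => i []; have [] := YP i.
have lYV k (s : 'I_n * bool) : (lY k s)^-1%g = lY k (s.1, ~~ s.2).
  by case: s => i []; rewrite /lY /letter_eval /= ?invgK.
pose ok (w : ('I_n * bool) * ('I_n * bool) * G) :=
  (w.2 \in gs) || (w.2 == 1%g) && (w.1.2 != (w.1.1.1, ~~ w.1.1.2)).
pose P w C N := ok w -> forall k, (N <= k)%N ->
  gromov_product o (A (lY k w.1.1)^-1%g o) (A w.2 (A (lY k w.1.2) o)) <= C.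
have [||C [N CN]] := @uniform_bound _ [seq (st, g) |
    st <- enum {: ('I_n * bool) * ('I_n * bool)}, g <- 1%g :: gs] P.
- move=> w C C' N N' CC' NN' wP /wP{}wP k N'k; apply: le_trans CC'.
  exact/wP/(leq_trans NN').
- move=> [[s t] g] _; rewrite /P /=.
  have [okw|] := boolP (ok (s, t, g)); last by exists 0, 0%N.
  (* Both [pt] values lie near [a], where an element of [gs] carries no such point to another; for
     [g = 1] the letters differ, hence so do their points. *)
  have ne : pt (s.1, ~~ s.2) <> boundary_act A g (pt t).
    move=> e; move: okw; rewrite /ok /= => /orP[ggs|/andP[/eqP g1 /eqP ts]].
      have [_ _ nt] := ptsP _ (pt_in t).
      have [_ _ ns] := ptsP _ (pt_in (s.1, ~~ s.2)).
      exact: gsr nt ns (esym e).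
    by apply/ts/pt_inj; rewrite e g1 boundary_act1.
  have [C [N CN]] :=
    bclass_far o (lYP (s.1, ~~ s.2)) (bclass_act A g (lYP t)) ne.
  by exists C, N => _ k Nk; rewrite lYV; exact: CN.
exists C => L.
have [||_ [M ML]] := @uniform_bound _ (enum 'I_n)
    (fun i _ M => forall k, (M <= k)%N -> L <= mdist o (A (Y i k) o)).
- by move=> i _ _ M M' _ MM' H k M'k; apply/H/(leq_trans MM').
- move=> i _.
  have /(gromov_simP o)/(_ L)[M ML] := bclass_gromov (lYP (i, true)).
  by exists 0, M => k Mk; have := ML k k Mk Mk; rewrite gp_self.
pose k := maxn M N; exists (fun i => Y i k); split=> [i|s t g okg].
  by apply: ML; [rewrite mem_enum|exact: leq_maxl].
apply: (CN (s, t, g)) => //; last exact: leq_maxr.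
apply: (allpairs_f (fun st g => (st, g))); first by rewrite mem_enum.
by case/orP: okg => [ggs|/andP[/eqP -> _]]; rewrite inE ?ggs ?eqxx ?orbT.
Qed.

(** Read from the right, each suffix sends [o] in the direction of its first letter. If the whole
    value were 1, the value of [l] would be the inverse of [g0], which displaces [o] too little. *)
Lemma ping_pong_value a n (g0 : G) (l : seq (('I_n * bool) * G)) :
  limit_set A a ->
  (forall e, e \in l -> e.2 <> 1%g -> boundary_act A e.2 a <> a) ->
  l != [::] -> sorted (@no_cancel G n) l ->
  exists X : 'I_n -> G, (g0 * syllable_eval id X l)%g <> 1%g.
Proof.
move=> la lmoved lN0 lsorted; have d0 := delta_ge0.
have [|C CX] := @ping_pong_elements [seq e.2 | e <- l & e.2 != 1%g] a n la.
  move=> g /mapP[p]; rewrite mem_filter => /andP[/eqP pN1 pl] ->.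
  exact: lmoved.
have [||D [_ lD]] := @uniform_bound _ l (fun e D _ => mdist o (A e.2 o) <= D).
- by move=> p D D' _ _ DD' _ /le_trans; apply.
- by move=> p _; exists (mdist o (A p.2 o)), 0%N.
(* [D] serves the last syllable, the other entry the induction step. *)
have C0 := normr_ge0 C; pose C1 := Num.max (`|C| + delta) D.
have C1C : `|C| + delta <= C1 by rewrite le_max lexx.
have C1D : D <= C1 by rewrite le_max lexx orbT.
have [X [XL XC]] :=
  CX (C1 + C1 + C1 + `|C| + delta + mdist o (A g0^-1%g o) + 1).
set L := (X in forall i, X <= _) in XL.
exists X => val1.
have letL (s : 'I_n * bool) : L <= mdist o (A (letter_eval X s) o).
  by case: s => i []; rewrite /letter_eval /= ?dist_actV.
suff: forall (p : ('I_n * bool) * G) l', (forall e, e \in p :: l' -> e \in l) ->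
    path (@no_cancel G n) p l' ->
    L - C1 <= gromov_product o (A (syllable_eval id X (p :: l')) o)
      (A (letter_eval X p.1) o).
  case: l lN0 lsorted val1 {lmoved CX lD XC} => // p l _ lsorted val1 est.
  have := est p l (fun e el => el) lsorted.
  rewrite -(mulg1_eq val1).
  have := gp_le_dist o (A g0^-1%g o) (A (letter_eval X p.1) o).
  rewrite /L; lra.
move=> p l'; elim: l' p => [|q l' IHl] p sub pl.
  have pD := lD p (sub p (mem_head _ _)).
  rewrite /= mulg1 actM gp_sym gp_flip.
  rewrite -[gromov_product (A _ o) _ _](gp_act A (letter_eval X p.1)^-1%g).
  rewrite !actK; have := letL p.1.
  have := gp_le_dist o (A p.2 o) (A (letter_eval X p.1)^-1%g o).
  rewrite gp_sym; lra.
have /andP[pq ql] : no_cancel p q && path (@no_cancel G n) q l' by [].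
have pl' := sub p (mem_head _ _); have pD := lD p pl'.
have IH := IHl q (fun e el => sub e (mem_behead (s := p :: q :: l') el)) ql.
set v := syllable_eval id X (q :: l') in IH *.
have -> : syllable_eval id X (p :: q :: l') = (letter_eval X p.1 * (p.2 * v))%g.
  by rewrite /v /= !mulgA.
rewrite actM gp_sym gp_flip.
rewrite -[gromov_product (A _ o) _ _](gp_act A (letter_eval X p.1)^-1%g).
rewrite !actK; have Lp := letL p.1.
suff: gromov_product o (A (letter_eval X p.1)^-1%g o) (A (p.2 * v)%g o) <= C1.
  rewrite gp_sym; lra.
rewrite leNgt; apply/negP => big.
set u := A (letter_eval X q.1) o in IH *.
have gv : `|C| + delta < gromov_product o (A (p.2 * v)%g o) (A p.2 u).
  rewrite actM; have := gp_base (A p.2 o) o (A p.2 (A v o)) (A p.2 u).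
  rewrite gp_act (metric_sym (A _ o)) => base.
  have := mdist_ge0 o (A g0^-1%g o); rewrite /L in IH; lra.
(* The inverse of the letter of [p] would now share a direction with [p.2 u], which [XC] forbids. *)
have := hyp_lt (le_lt_trans C1C big) gv; rewrite addrK ltNge => /negP; apply.
apply: le_trans (ler_norm C); apply: XC.
have [p1|pN1] := eqVneq p.2 1%g.
  by move: pq; rewrite /no_cancel p1 eqxx /= => ->; rewrite orbT.
by rewrite map_f // mem_filter pN1.
Qed.

(** The support of each element is invariant under that element, so both orders of composition agree
    on the limit set, and the commutator lies in the elliptic radical. *)
Lemma disjoint_support_commute (u v : G) : elliptic_radical A = [set 1%g] ->
  (forall b, limit_set A b ->
     boundary_act A u b = b \/ boundary_act A v b = b) ->
  [~ u, v]%g = 1%g.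
Proof.
move=> rad1 uv; apply/eqP/commgP.
have uvb b : limit_set A b -> boundary_act A u (boundary_act A v b) =
    boundary_act A v (boundary_act A u b).
  move=> lb; have inj w c d : boundary_act A w c = boundary_act A w d -> c = d.
    by move=> /(congr1 (boundary_act A w^-1%g)); rewrite !boundary_actK.
  have [ub|vb] := uv b lb.
    by have [e|/inj e] := uv _ (limit_set_act v lb); rewrite ?ub e ?ub.
  by have [/inj e|e] := uv _ (limit_set_act u lb); rewrite ?vb e ?vb.
suff: elliptic_radical A ((v * u)^-1 * (u * v))%g.
  by rewrite rad1 => /mulg1_eq; rewrite invgK => /esym.
move=> b lb.
by rewrite 2!boundary_actM uvb // -(boundary_actM A v) boundary_actK.
Qed.

(* Compare the two pairings of four points [b1 b2 c1 c2] seen from [o] and from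
   [x^-1 o]: the cross ratio does not depend on the base point. *)
Lemma cross_ratio_separation (C L : R) (p : bool -> S) (x : G)
    (b : bool -> bool -> S) : C + delta *+ 3 < L ->
  gromov_product o (p false) (p true) <= C ->
  (forall i j, L <= gromov_product o (p i) (b i j)) ->
  ~ (forall i j, L <= gromov_product o (p j) (A x (b i j))).
Proof.
move=> CL pC near1 near2; have d0 := delta_ge0.
have close (q u v : S) :
    L <= gromov_product o q u -> L <= gromov_product o q v ->
    L - delta <= gromov_product o u v.
  by rewrite (gp_sym o q u) => qu qv; exact: hyp_le qu qv.
have apart (u v : S) : L <= gromov_product o (p false) u ->
    L <= gromov_product o (p true) v -> gromov_product o u v <= C + delta *+ 2.
  move=> pu pv; rewrite leNgt; apply/negP => uv.
  have pu' : C + delta *+ 2 < gromov_product o (p false) u by lra.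
  have pv' : C + delta < gromov_product o v (p true) by rewrite gp_sym; lra.
  have uv' : C + delta < gromov_product o (p false) v.
    have -> : C + delta = C + delta *+ 2 - delta by rewrite mulr2n addrA addrK.
    exact: hyp_lt pu' uv.
  by have := hyp_lt uv' pv'; rewrite addrK ltNge pC.
(* Seen from [o] the points pair up by the first index, seen from [x^-1 o] by the second; the cross
   ratio would be positive from one and negative from the other. *)
have := gp_cross_ratio o (A x^-1%g o)
  (b false false) (b false true) (b true false) (b true true).
have act (u v : S) :
    gromov_product (A x^-1%g o) u v = gromov_product o (A x u) (A x v).
  by rewrite -(gp_act A x) actKV.
rewrite !act.
have := close _ _ _ (near1 false false) (near1 false true).
have := close _ _ _ (near1 true false) (near1 true true).
have := apart _ _ (near1 false false) (near1 true false).
have := apart _ _ (near1 false true) (near1 true true).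
have := close _ _ _ (near2 false false) (near2 true false).
have := close _ _ _ (near2 false true) (near2 true true).
have := apart _ _ (near2 false false) (near2 false true).
have := apart _ _ (near2 true false) (near2 true true).
lra.
Qed.

(* The support of [t g t^-1] lies in the shadow of [t o]. *)
Lemma conjugate_support (t g : G) a r x : bclass a x ->
  (forall b, limit_set A b -> nearb o r a b -> boundary_act A g b = b) ->
  near o (r + delta *+ 5 + 1) (fun=> A t^-1%g o) x ->
  forall b y, limit_set A b -> bclass b y ->
    boundary_act A (g ^ t^-1)%g b <> b ->
    near o (mdist o (A t o) - (r + delta *+ 5)) (fun=> A t o) y.
Proof.
move=> ax fixg tx b y lb byy moved.
have ty := bclass_act A t^-1%g byy; set z := A t^-1%g \o y in ty.
(* Otherwise [g] would fix [t^-1 b]: two [delta] are lost in [far_or_near] and two in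
   [near_nearb]. *)
have farz : far o (r + delta *+ 4) x z.
  have [//|nxz] := far_or_near (r + delta *+ 4)
    (gromov_tight o (bclass_gromov ax)) (gromov_tight o (bclass_gromov ty)).
  case: moved; rewrite conjgE invgK !boundary_actM fixg ?boundary_actKV //.
    exact: limit_set_act.
  by apply: nearb_le (near_nearb ax ty nxz); rewrite -addrA; lra.
have tz : far o (r + delta *+ 4 + delta) (fun=> A t^-1%g o) z.
  by apply: far_near farz (near_sym tx) _; have := delta_ge0; lra.
have [N Ntz] := far_act A t tz; exists N => i j Ni Nj; rewrite gp_flip.
have := Ntz i j Ni Nj; rewrite /z /= !actKV; lra.
Qed.

Lemma MIF_topologically_free : MIF G -> elliptic_radical A = [set 1%g] ->
  topologically_free (limit_act A).
Proof.
move=> mifG rad1 g /eqP gN1; apply: contrapT => /eqP/set0P[a'].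
case/(interior_limitP o) => r fixg.
set a := set_val a' in fixg; have la : limit_set A a := set_mem (valP a').
have {}fixg b : limit_set A b -> nearb o r a b -> boundary_act A g b = b.
  move=> lb nab.
  pose b' : limit_set A := exist (fun b => b \in limit_set A) b (mem_set lb).
  by have /(congr1 val) := fixg b' nab.
(* The elements [h1 n] and [h2 n] send [o] towards the distinct points [c] and [c'], and their
   inverses send it towards [a]; conjugating by them puts the supports in separate shadows. *)
have [c [c' [_ [[lc lc' _] [cc' _ _]]]]] := limit_points3 o gt.
have [h1 [h1c h1a]] := double_limit o gt lc la.
have [h2 [h2c h2a]] := double_limit o gt lc' la.
have [C [N farC]] := bclass_far o h1c h2c cc'.
have [x0 ax0] := bclass_nonempty a.
pose L := C + delta *+ 3 + 1; pose K := r + delta *+ 5.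
have far_out h e : bclass e (fun n => A (h n) o) ->
    bclass a (fun n => A (h n)^-1%g o) ->
    exists M, forall n, (M <= n)%N -> L + K <= mdist o (A (h n) o) /\
      near o (K + 1) (fun=> A (h n)^-1%g o) x0.
  move=> he ha; have /(gromov_simP o)/(_ (L + K))[M1 hM1] := bclass_gromov he.
  have /(gromov_simP o)/(_ (K + 1))[M2 hM2] := bclass_sim ha ax0.
  exists (maxn M1 M2) => n; rewrite geq_max => /andP[M1n M2n]; split.
    by have := hM1 n n M1n M1n; rewrite gp_self.
  by exists M2 => _ j _ M2j; exact: hM2.
have [M1 hM1] := far_out _ _ h1c h1a; have [M2 hM2] := far_out _ _ h2c h2a.
pose n := maxn N (maxn M1 M2).
have [Nn M1n M2n] : [/\ N <= n, M1 <= n & M2 <= n]%N.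
  by rewrite /n !leq_max !leqnn !orbT.
pose t (i : bool) := if i then h2 n else h1 n.
have tP i : L + K <= mdist o (A (t i) o) /\
    near o (K + 1) (fun=> A (t i)^-1%g o) x0.
  by case: i; [exact: hM2|exact: hM1].
pose gg i := (g ^ (t i)^-1)%g.
have ggN1 i : gg i != 1%g by rewrite /gg conjg_eq1.
have supp i b y : limit_set A b -> bclass b y -> boundary_act A (gg i) b <> b ->
    near o L (fun=> A (t i) o) y.
  move=> lb byy gb; have [Lt nt] := tP i.
  apply: near_le (conjugate_support ax0 fixg nt lb byy gb); rewrite -/K; lra.
have [x xP] := MIF_conjugator mifG (ggN1 false) (ggN1 true).
(* The commutators are nontrivial, so the supports of [gg i] and of the conjugate of [gg j] by [x]
   share a limit point [b]; [q] is a late term of a sequence converging to [b]. *)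
have /choice[q qP] : forall ij : bool * bool, exists q,
    L <= gromov_product o (A (t ij.1) o) q /\
    L <= gromov_product o (A (t ij.2) o) (A x q).
  move=> [i j] /=.
  have [b [lb gi gj]] : exists b, [/\ limit_set A b,
      boundary_act A (gg i) b <> b & boundary_act A (gg j ^ x)%g b <> b].
    apply: contrapT => nex; have : [~ gg i, gg j ^ x]%g != 1%g.
      by apply: xP; [case: i {nex}|case: j {nex}]; rewrite !inE eqxx ?orbT.
    rewrite disjoint_support_commute ?eqxx // => b lb.
    have [ib|ib] := pselect (boundary_act A (gg i) b = b); first by left.
    by right; apply: contrapT => jb; apply: nex; exists b.
  have [y byy] := bclass_nonempty b.
  have [M yM] := supp i b y lb byy gi.
  have gj' : boundary_act A (gg j) (boundary_act A x b) <> boundary_act A x b.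
    move=> e; apply: gj.
    rewrite conjgE (boundary_actM A x^-1%g) (boundary_actM A (gg j)) e.
    exact: boundary_actK.
  have [M' yM'] := supp j _ _ (limit_set_act x lb) (bclass_act A x byy) gj'.
  exists (y (maxn M M')); split; [apply: (yM M) => //|apply: (yM' M')] => //;
    by rewrite ?leq_maxl ?leq_maxr.
apply: (@cross_ratio_separation C L (fun i => A (t i) o) x
  (fun i j => q (i, j))).
- by rewrite /L ltrDl.
- exact: farC.
- by move=> i j; have [] := qP (i, j).
- by move=> i j; have [] := qP (i, j).
Qed.

End PingPong.
End Hyperbolicity.

(** * The equivalence of the three conditions *)

Section LimFree.
Context {R : realType} {G : groupType}.

Lemma general_type_inhabited (S : metricType R) (A : isom_action G S) :
  general_type A -> inhabited S.
Proof.
move=> [_ [g [_ [[_ [a _]] _ _]]]].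
by have [x _ _] := bclassP a; constructor; exact: (x 0%N).
Qed.

Lemma lim_free_MIF : lim_free R G -> MIF G.
Proof.
move=> [_ [S [A [[_ [delta d0 hyp]] gt tf]]]] n.
apply: MIF_reduced => g l lN0 ls.
have [pt] := general_type_inhabited gt.
pose gs := [seq p.2 | p <- l & p.2 != 1%g].
have [h|a la moved] := topologically_free_moved d0 hyp pt gt (gs := gs) tf.
  by case/mapP=> p; rewrite mem_filter => /andP[/eqP pN1 _] ->.
apply: (ping_pong_value d0 hyp pt gt g la) => // p pl pN1.
by apply: moved; rewrite map_f // mem_filter pl andbT; exact/eqP.
Qed.

End LimFree.

Theorem theorem1p2 (R : realType) (G : groupType)
    (hG : faithful_weakly_hyperbolic R G) :
  [<-> lim_free R G;
       forall (S : metricType R) (A : isom_action G S),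
         hyperbolic S -> general_type A ->
         elliptic_radical A = [set 1%g] ->
         topologically_free (limit_act A);
       MIF G].
Proof.
have MIF_free : MIF G -> forall (S : metricType R) (A : isom_action G S),
    hyperbolic S -> general_type A -> elliptic_radical A = [set 1%g] ->
    topologically_free (limit_act A).
  move=> mifG S A [_ [delta d0 hyp]] gt rad.
  have [pt] := general_type_inhabited gt.
  exact: (MIF_topologically_free d0 hyp pt gt mifG rad).
have free_lim_free : (forall (S : metricType R) (A : isom_action G S),
    hyperbolic S -> general_type A -> elliptic_radical A = [set 1%g] ->
    topologically_free (limit_act A)) -> lim_free R G.
  (* Faithfulness on the limit set makes the elliptic radical of this action trivial, so [free]
     applies to it. *)
  move=> free; have [S [A [hypS gt faithful]]] := hG.
  split; exists S, A; split=> //; apply: free => //.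
  apply/seteqP; split=> [g fix_g|_ ->].
    apply: faithful => a; apply: val_inj => /=; apply: fix_g.
    exact: set_mem (valP a).
  move=> a la; have [_ [delta _ hyp]] := hypS; exact: (boundary_act1 hyp).
(* The implications proved form the cycle (a), (c), (b), (a); in the listed order each arrow
   composes two of them. *)
tfae.
- by move=> /lim_free_MIF/MIF_free.
- by move=> /free_lim_free/lim_free_MIF.
- by move=> /MIF_free/free_lim_free.
Qed.
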